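(* Let $\mathcal X,\mathcal Y$ be real separable Hilbert spaces with $\mathcal Y\ne\{0\}$, let $t>0$, $1\le p<\infty$, $B,L>0$, $\sigma>0$, and let $\mu$ be a probability measure on $\mathcal X$ satisfying conditions (i), (ii), (iii-L), (iii-U) of the context. Suppose the noise is Gaussian white noise on $\mathcal Y$, that $w_i=i$ for all $i$, and that the eigenvalues of the covariance operator of $\mu$ are $\lambda_i=\exp(-\tau i^{\omega})$, $i\in\mathbb N$, for some $\tau>0$ and $\omega\ge1$. Then $$\mathcal L_m(\mathcal F^t_{B,L};L^p_\mu)\asymp_{\tau,\omega,\iota,t,p}\bigl(\log(m/\sigma^2)\bigr)^{\frac{\omega}{\omega+1}},\qquad m\to\infty,$$ where $\mathcal L_m(\mathcal F^t_{B,L};L^p_\mu)=-\log(\mathcal M_m(\mathcal F^t_{B,L};L^p_\mu))$ and $\mathcal M_m$ is either the fixed-design or the random-design minimax risk.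
   Context: Conditions on $\mu$ (a Borel probability measure on $\mathcal X$): (i) $\mu$ has mean zero and $\int_{\mathcal X}\|X\|_{\mathcal X}^2\,d\mu(X)<\infty$. (ii) Let $\lambda_1\ge\lambda_2\ge\cdots>0$ and $\{\phi_i\}_i\subset\mathcal X$ be the eigenvalues and an orthonormal basis of eigenvectors of the covariance operator of $\mu$. The real random variables $\xi_i=\langle X,\phi_i\rangle_{\mathcal X}/\sqrt{\lambda_i}$, $X\sim\mu$, are independent. (iii-L) Each $\xi_i$ has a density $\nu_i$ with respect to Lebesgue measure, and there are constants $a,b>0$ (independent of $i$) with $\nu_i(x)\ge b$ for all $|x|\le a$ and all $i$. Put $\iota=2ab\le1$. (iii-U) With $p'=\max\{p,2\}$, $\sup_i(\mathbb E|\xi_i|^{p'})^{1/p'}<\infty$. Observations: $Y_i=F(X_i)+\sigma E_i$, $i=1,\dots,m$, with $E_1,\dots,E_m$ i.i.d. Gaussian white noise on $\mathcal Y$, i.e. $Y_i$ is observed through $\langle Y_i,y\rangle=\langle F(X_i),y\rangle_{\mathcal Y}+\sigma\langle E_i,y\rangle$, $y\in\mathcal Y$, where $y\mapsto\langle E_i,y\rangle$ is a centered Gaussian linear process with $\mathbb E[\langle E_i,y\rangle\langle E_i,y'\rangle]=\langle y,y'\rangle_{\mathcal Y}$. Class: let $\{\psi_i\}_i$ be an orthonormal basis of $\mathcal Y$ and $(w_i)$ the weights; set $\|Y\|_{\mathcal Y^t}^2=\sum_i w_i^{2t}|\langle Y,\psi_i\rangle_{\mathcal Y}|^2$ and $\mathcal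 Y^t=\{Y\in\mathcal Y:\|Y\|_{\mathcal Y^t}<\infty\}$. $\mathcal F^t_{B,L}$ is the set of $F:\mathcal X\to\mathcal Y$ with $\|F(X)\|_{\mathcal Y^t}\le B$ and $\|F(X)-F(X')\|_{\mathcal Y}\le L\|X-X'\|_{\mathcal X}$ for all $X,X'\in\mathcal X$. Norm: $\|F\|_{L^p_\mu(\mathcal X;\mathcal Y)}=(\int_{\mathcal X}\|F(X)\|_{\mathcal Y}^p\,d\mu(X))^{1/p}$. Minimax risks: an estimator $\widehat F$ is a mapping from the data to $L^p_\mu(\mathcal X;\mathcal Y)$. Fixed design: $\mathcal M_m(\mathcal F;L^p_\mu)=\inf_{\mathcal D}\inf_{\widehat F}\sup_{F\in\mathcal F}\mathbb E\|F-\widehat F\|_{L^p_\mu(\mathcal X;\mathcal Y)}$, with infimum over designs $\mathcal D=\{X_1,\dots,X_m\}\subset\mathcal X$ and expectation over the $E_i$. Random design: $\mathcal M_m(\mathcal F;L^p_\mu)=\inf_\nu\inf_{\widehat F}\sup_{F\in\mathcal F}\mathbb E\|F-\widehat F\|_{L^p_\mu(\mathcal X;\mathcal Y)}$, with infimum over probability measures $\nu$ on $\mathcal X$, $X_1,\dots,X_m$ i.i.d. from $\nu$ independent of the $E_i$, and expectation over the $X_i$ and $E_i$. Asymptotic notation: $A(m)\lesssim_r A'(m)$ as $m\to\infty$ means there is a constant $c(r)>0$ depending only on the parameters $r$ such that $A(m)\le c(r)A'(m)$ for all sufficiently large $m$ (the threshold may depend on all fixed data); $A\asymp_r A'$ means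 $A\lesssim_r A'$ and $A'\lesssim_r A$. *)

(* Defs.v *)
From HB Require Import structures.
From mathcomp Require Import all_boot all_order all_algebra.
From mathcomp Require Import all_classical all_reals all_analysis.

Set Implicit Arguments.
Unset Strict Implicit.
Unset Printing Implicit Defensive.

Import Order.TTheory GRing.Theory Num.Theory.
Import numFieldNormedType.Exports.

Local Open Scope classical_set_scope.
Local Open Scope ring_scope.

HB.mixin Record CompleteNormedModule_isHilbert (R : realType) V
    of CompleteNormedModule R V := {
  inner : {dot V for (@idfun R)} ;
  inner_norm : forall x : V, inner x x = `|x| ^+ 2 }.

#[short(type="hilbertType")]
HB.structure Definition Hilbert (R : realType) :=
  {V of CompleteNormedModule_isHilbert R V & CompleteNormedModule R V}.

Definition separable (T : topologicalType) :=
  exists A : set T, countable A /\ dense A.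

(* All families are indexed from 0: the entry [i : nat] is the one that is
   numbered i + 1 on paper. A basis is indexed by a set [D] of naturals, so as
   to cover both finite ([D] = `I_n) and infinite ([D] = setT) dimension; the
   values [e i] for [i] outside of [D] are irrelevant. *)
Definition initial_segment (D : set nat) := D = setT \/ exists n, D = `I_n.

Definition orthonormal_basis (R : realType) (H : hilbertType R)
    (D : set nat) (e : nat -> H) :=
  (forall i j, D i -> D j -> inner (e i) (e j) = (i == j)%:R) /\
  (forall x : H,
     (fun n => \sum_(0 <= i < n | i \in D) inner x (e i) *: e i) @ \oo --> x).

Notation borel T := (g_sigma_algebraType (@open T)).

Section independence.
Context d (T : measurableType d) (R : realType) (P : probability T R).

(* For sigma-algebras [G i], mutual independence: product rule over every
   finite subfamily. *)
Definition mutually_independent (G : nat -> set (set T)) :=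
  forall (J : seq nat) (A : nat -> set T), uniq J ->
    (forall i, i \in J -> G i (A i)) ->
    P (\bigcap_(i in [set` J]) A i) = (\prod_(i <- J) P (A i))%E.

Definition independent_rvs (xi : nat -> T -> R) :=
  mutually_independent (fun i => preimage_set_system setT (xi i) measurable).

Definition sigma_process (I : Type) (W : I -> T -> R) : set (set T) :=
  <<s [set A | exists y, preimage_set_system setT (W y) measurable A] >>.

Definition has_density (xi : T -> R) (f : R -> R) :=
  [/\ measurable_fun setT f, (forall x, 0 <= f x) &
      forall A : set R, measurable A ->
        P (xi @^-1` A) = (\int[lebesgue_measure]_(x in A) (f x)%:E)%E].

(* [s] is the standard deviation. The degenerate case is split off because
   [normal_prob m 0] is not the Dirac mass at [m] in the library. *)
Definition gaussian_rv (m s : R) (V : T -> R) :=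
  if s == 0 then {ae P, forall w, V w = m}
  else forall A : set R, measurable A -> P (V @^-1` A) = normal_prob m s A.

(* As linear combinations of the [W y] are a.s. of the form [W y'], the field
   [white_gaussian] makes the whole process [W] jointly Gaussian. *)
Record white_noise (Y : hilbertType R) (W : Y -> T -> R) : Prop := {
  white_measurable : forall y, measurable_fun setT (W y) ;
  white_linear : forall (c : R) y y',
    {ae P, forall w, W (c *: y + y') w = c * W y w + W y' w} ;
  white_gaussian : forall y, gaussian_rv 0 `|y| (W y) ;
  white_covariance : forall y y',
    ('E_P[fun w => (W y w * W y' w)%R] = (inner y y')%:E)%E }.

Definition iid_white_noise (Y : hilbertType R) (E : nat -> Y -> T -> R) :=
  (forall i, white_noise (E i)) /\
  mutually_independent (fun i => sigma_process (E i)).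

End independence.

Section conditions_on_mu.
Context (R : realType) (X : hilbertType R) (mu : probability (borel X) R).

(* The mean is the Bochner integral of the identity; it is tested here against
   every vector. *)
Definition mean_zero := forall v : X, ('E_mu[fun x => inner (x : X) v] = 0)%E.

Definition finite_second_moment :=
  (\int[mu]_x (`|x : X| ^+ 2)%:E < +oo)%E.

Definition covariance_operator (C : X -> X) := forall u v : X,
  ('E_mu[fun x => (inner (x : X) u * inner (x : X) v)%R] = (inner (C u) v)%:E)%E.

Definition spectral_basis (C : X -> X) (lambda : nat -> R) (phi : nat -> X) :=
  [/\ forall i, 0 < lambda i,
      {homo lambda : i j / (i <= j)%N >-> j <= i},
      orthonormal_basis setT phi &
      forall i, C (phi i) = lambda i *: phi i].

Definition kl_coord (lambda : nat -> R) (phi : nat -> X) (i : nat)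
    (x : borel X) : R :=
  inner (x : X) (phi i) / Num.sqrt (lambda i).

Definition small_ball_density (xi : nat -> borel X -> R) (a b : R) :=
  exists nu : nat -> R -> R,
    (forall i, has_density mu (xi i) (nu i)) /\
    (forall i x, `|x| <= a -> b <= nu i x).

Definition bounded_moments (p : R) (xi : nat -> borel X -> R) :=
  (ereal_sup [set Lnorm mu (Num.max p 2)%:E (EFin \o xi i) | i in setT]
     < +oo)%E.

End conditions_on_mu.

Section smooth_lipschitz_class.
Context (R : realType) (X Y : hilbertType R).

Definition weighted_norm (D : set nat) (psi : nat -> Y) (w : nat -> R) (t : R)
    (y : Y) : \bar R :=
  ((\sum_(i <oo | i \in D) (w i `^ (2 * t) * `|inner y (psi i)| ^+ 2)%:E)
     `^ 2^-1)%E.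

Definition lipschitz_class (D : set nat) (psi : nat -> Y) (w : nat -> R)
    (t B L : R) : set (X -> Y) :=
  [set F | (forall x, (weighted_norm D psi w t (F x) <= B%:E)%E) /\
           (forall x x', `|F x - F x'| <= L * `|x - x'|)].

End smooth_lipschitz_class.

Section Lp.
Context (R : realType) (X Y : hilbertType R) (mu : probability (borel X) R).
Variable p : R.

Definition Lp_norm (G : X -> Y) : \bar R :=
  Lnorm mu p%:E (fun x : borel X => `|G x|%:E).

Definition Lp_dist (G H : X -> Y) : \bar R := Lp_norm (fun x => G x - H x).

(* Functions are not quotiented by almost everywhere equality. Since [Y] is
   separable, Borel measurability amounts to strong measurability. *)
Definition Lp_space : set (X -> Y) :=
  [set G | measurable_fun setT (G : borel X -> borel Y) /\
           (Lp_norm G < +oo)%E].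

Definition Lp_open (U : set (X -> Y)) := U `<=` Lp_space /\
  forall G, U G -> exists2 e : R, 0 < e &
    forall H, Lp_space H -> (Lp_dist H G < e%:E)%E -> U H.

(* Estimators are measurable maps from the data to Lp with its Borel
   sigma-algebra. *)
Definition estimators d (Data : measurableType d) : set (Data -> X -> Y) :=
  [set h | (forall z, Lp_space (h z)) /\
           (forall U, Lp_open U -> measurable (h @^-1` U))].

End Lp.
Arguments estimators {R X} Y mu p {d} Data.

Section iid_law.
Context d (T : measurableType d) (R : realType).

Definition tuple_cons m (z : T * m.-tuple T) : m.+1.-tuple T :=
  [tuple of z.1 :: z.2].

Let measurable_tuple_cons m : measurable_fun setT (@tuple_cons m).
Proof. exact: measurable_cons. Qed.

HB.instance Definition _ m :=
  isMeasurableFun.Build _ _ _ _ (@tuple_cons m) (@measurable_tuple_cons m).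

(* The m-fold product of [nu], i.e. the law of m i.i.d. draws from [nu]. *)
Fixpoint iid_law (nu : probability T R) (m : nat) :
    probability (m.-tuple T) R :=
  match m with
  | 0 => \d_[tuple]
  | m'.+1 => distribution (nu \x iid_law nu m')%E (@tuple_cons m')
  end.

End iid_law.

(* One observation is a function [y |-> <Y_i, y>]; the space of the m
   observations has the product sigma-algebra. *)
Definition obs_cylinders (R : realType) (Y : hilbertType R) (m : nat) :
    set (set ('I_m -> Y -> R)) :=
  [set A | exists i y (B : set R), measurable B /\ A = [set d | B (d i y)]].

Notation obs_space Y m := (g_sigma_algebraType (@obs_cylinders _ Y m)).

Section minimax.
Context (R : realType) (X Y : hilbertType R) (mu : probability (borel X) R).
Context d (Omega : measurableType d) (P : probability Omega R).
Variables (E : nat -> Y -> Omega -> R) (sigma p : R).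

Definition observations m (F : X -> Y) (x : m.-tuple (borel X)) (w : Omega) :
    obs_space Y m :=
  fun i y => inner (F (tnth x i)) y + sigma * E i y w.

Local Open Scope ereal_scope.

Definition fixed_design_risk (class : set (X -> Y)) (m : nat) : \bar R :=
  ereal_inf [set
    ereal_inf [set
      ereal_sup [set
        \int[P]_w Lp_dist mu p F (h (observations F x w))
      | F in class]
    | h in estimators Y mu p (obs_space Y m)]
  | x in [set: m.-tuple (borel X)]].

Definition random_design_risk (class : set (X -> Y)) (m : nat) : \bar R :=
  ereal_inf [set
    ereal_inf [set
      ereal_sup [set
        \int[iid_law nu m \x P]_z
          Lp_dist mu p F (h (z.1, observations F z.1 z.2))
      | F in class]
    | h in estimators Y mu p (m.-tuple (borel X) * obs_space Y m)%type]
  | nu in [set: probability (borel X) R]].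

End minimax.

Definition lesssim (R : realType) (c : R) (A A' : nat -> \bar R) :=
  \forall m \near \oo, (A m <= c%:E * A' m)%E.

(* Main.v *)
From HB Require Import structures.
Require Import Defs.
From mathcomp Require Import all_boot all_order all_algebra.
From mathcomp Require Import all_classical all_reals all_analysis.
From mathcomp Require Import measurable_realfun ring lra zify.

(** Only the order of the exponents matters: the constants may depend on [tau],
    [omega], [iota], [t] and [p], and since [sigma] is fixed while [m] grows,
    [ln (m / sigma^2)] may be read as [ln m]. Both bounds use the first [n]
    Karhunen-Loeve coordinates of [X] and a grid with about [exp (c n^omega)] cells
    along each axis, hence [exp (c n^(omega + 1))] cells in all. A sample of size
    [m] resolves such a grid for [n^(omega + 1)] up to a multiple of [ln m], and the
    attainable accuracy is then [exp (- c' n^omega)], where [n^omega] is a multiple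
    of [(ln m)^(omega / (omega + 1))].

    Lower bound. Take a box in these coordinates with more than [2 m] cells, and on
    each cell a Lipschitz bump of height [exp (- c n^omega)]. Whatever the design is,
    half of the bumps vanish at all design points, and switching these on or off
    leaves the data unchanged. Averaging over all sets of bumps
    ([ge_half_of_paired_losses]), every estimator has a risk of the order of the
    height times the mass of the unhit cells, for both kinds of designs and without
    any use of the noise. By independence of the coordinates and the lower bound on
    their densities, the cells have total mass at least [(iota / 2)^n]
    ([mu_cell_core]), and this is no loss as [n <= n^omega].

    Upper bound. The estimator is constant on the cells of a grid on a ball of
    radius [exp (n^omega)], with values in the span of [exp (n^omega)] basis vectors
    of [Y]. The mass off the grid and the tail of the expansion of [X] are bounded by
    the Chebyshev inequality: the eigenvalues beyond the [n]-th add up to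
    [exp (- tau n^omega / 2)] ([residual_second_moment]). The noise is bounded by the
    crudest sum over all coefficients ([conditional_risk_le]); it is negligible when
    [m] exceeds a large power of the number of cells. A fixed design visits the cell
    centers equally often; a random one draws them uniformly, and weighting the
    observations by the number of cells keeps the estimator unbiased.

    Finally [lesssim_neg_ln_of_ge] and [lesssim_rate_of_le] choose [n] in terms of
    [m]. *)

Set Implicit Arguments.
Unset Strict Implicit.
Unset Printing Implicit Defensive.

Import Order.TTheory GRing.Theory Num.Theory.
Import numFieldNormedType.Exports.

Local Open Scope classical_set_scope.
Local Open Scope ring_scope.

(** * Inner products and orthonormal expansions *)

Section inner_product.
Context (R : realType) (H : hilbertType R).
Implicit Types (x y z : H) (a : R).

Lemma inner_sym x y : inner x y = inner y x.
Proof. by have := hermC (@inner R H) x y; rewrite expr0 mul1r. Qed.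

Lemma innerDl x y z : inner (x + y) z = inner x z + inner y z.
Proof. exact: linearDl. Qed.

Lemma innerBl x y z : inner (x - y) z = inner x z - inner y z.
Proof. exact: linearBl. Qed.

Lemma innerZl a x z : inner (a *: x) z = a * inner x z.
Proof. exact: linearZl_LR. Qed.

Lemma inner0l x : inner 0 x = 0.
Proof. exact: linear0l. Qed.

Lemma inner_suml I (r : seq I) (P : pred I) (f : I -> H) z :
  inner (\sum_(i <- r | P i) f i) z = \sum_(i <- r | P i) inner (f i) z.
Proof. exact: linear_sumlz. Qed.

Lemma innerDr x y z : inner z (x + y) = inner z x + inner z y.
Proof. by rewrite inner_sym innerDl !(inner_sym z). Qed.

Lemma innerZr a x z : inner z (a *: x) = a * inner z x.
Proof. by rewrite inner_sym innerZl (inner_sym z). Qed.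

Lemma inner_sumr I (r : seq I) (P : pred I) (f : I -> H) z :
  inner z (\sum_(i <- r | P i) f i) = \sum_(i <- r | P i) inner z (f i).
Proof. by rewrite inner_sym inner_suml; apply: eq_bigr => i _; exact: inner_sym. Qed.

Lemma sqr_normD x y :
  `|x + y| ^+ 2 = `|x| ^+ 2 + 2 * inner x y + `|y| ^+ 2.
Proof.
rewrite -!inner_norm innerDl !innerDr (inner_sym y x).
by ring.
Qed.

Lemma cauchy_schwarz x y : `|inner x y| <= `|x| * `|y|.
Proof.
have [->|y0] := eqVneq y 0.
  by rewrite inner_sym inner0l !normr0 mulr0.
have y2 : 0 < `|y| ^+ 2 by rewrite exprn_gt0// normr_gt0.
have := sqr_ge0 `|x - (inner x y / `|y| ^+ 2) *: y|.
rewrite sqr_normD -scaleNr innerZr normrZ exprMn real_normK ?num_real//.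
rewrite sqrrN exprMn expr2 => h.
rewrite -(@ler_pXn2r _ 2)// ?nnegrE ?mulr_ge0// exprMn real_normK ?num_real//.
rewrite -(@ler_pM2r _ (`|y| ^+ 2)^-1) ?invr_gt0//.
rewrite mulfK ?gt_eqF// -subr_ge0.
move: h; set i := inner x y; set s := `|y| ^+ 2; set t := `|x| * `|x|.
rewrite (_ : t + _ + _ = `|x| ^+ 2 - i ^+ 2 / s)//.
by rewrite /t; field; rewrite gt_eqF.
Qed.

Lemma continuous_inner z : continuous (inner^~ z : H -> R).
Proof.
move=> x; apply/cvgrPdist_lt => e e0.
near=> y.
rewrite -innerBl (le_lt_trans (cauchy_schwarz _ _))//.
have z1 : 0 < `|z| + 1 by rewrite ltr_wpDl.
rewrite (@le_lt_trans _ _ (`|x - y| * (`|z| + 1)))//.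
  by rewrite ler_wpM2l// lerDl.
rewrite -ltr_pdivlMr//.
near: y; apply: cvgr_dist_lt => //.
by rewrite divr_gt0// ltr_wpDl.
Unshelve. all: by end_near. Qed.

End inner_product.

Section orthonormal_expansion.
Context (R : realType) (H : hilbertType R) (D : set nat) (e : nat -> H).

Definition basis_proj (n : nat) (x : H) : H :=
  \sum_(0 <= i < n | i \in D) inner x (e i) *: e i.

Hypothesis he : orthonormal_basis D e.

Lemma inner_basis_sum (k n : nat) (c : nat -> R) (j : nat) : D j ->
  inner (\sum_(k <= i < n | i \in D) c i *: e i) (e j)
    = if (k <= j < n)%N then c j else 0.
Proof.
move=> Dj; have [ho _] := he.
rewrite inner_suml; under eq_bigr => i /[!inE] Di do rewrite innerZl ho//.
rewrite (eq_bigr (fun i => if i == j then c j else 0)); last first.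
  by move=> i _; case: eqP => [->|_]; rewrite ?mulr1 ?mulr0.
rewrite -big_mkcondr/=.
case: ifPn => [kjn|].
  rewrite -big_filter (_ : [seq _ <- _ | _] = [:: j]) ?big_seq1//.
  rewrite (@eq_filter _ _ (pred1 j)); first last.
    by move=> i /=; case: eqP => [->|]; rewrite ?andbF// andbT mem_set.
  rewrite filter_pred1_uniq ?iota_uniq//.
  by rewrite mem_index_iota.
move=> kjn; rewrite big_nat_cond big1// => i /andP[+ /andP[_ /eqP ij]].
by rewrite ij (negbTE kjn).
Qed.

Lemma sqr_norm_basis_sum (k n : nat) (c : nat -> R) :
  `|\sum_(k <= i < n | i \in D) c i *: e i| ^+ 2
    = \sum_(k <= i < n | i \in D) c i ^+ 2.
Proof.
rewrite -inner_norm inner_sumr big_nat_cond [RHS]big_nat_cond.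
apply: eq_bigr => i /andP[kin /[!inE] Di].
by rewrite innerZr inner_basis_sum// kin expr2.
Qed.

Lemma norm_basis i : D i -> `|e i| = 1.
Proof.
move=> Di; have [ho _] := he.
by apply/eqP; rewrite -sqrp_eq1// -inner_norm ho// eqxx.
Qed.

Lemma norm_basis_proj n y : `|basis_proj n y| <= `|y|.
Proof.
have [->|y0] := eqVneq (basis_proj n y) 0; first by rewrite normr0.
rewrite -(@ler_pM2l _ `|basis_proj n y|) ?normr_gt0//.
rewrite (le_trans _ (cauchy_schwarz _ _))// -expr2 sqr_norm_basis_sum.
rewrite inner_suml; under [X in `|X|]eq_bigr do rewrite innerZl (inner_sym (e _)) -expr2.
exact: ler_norm.
Qed.

(** The partial sums converge to [x], so that a bound on the tails of the
    coefficients passes to the limit. *)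
Lemma sqr_norm_residual_le (k : nat) (x : H) (C : R) :
  (forall n, (k <= n)%N ->
    \sum_(k <= i < n | i \in D) inner x (e i) ^+ 2 <= C) ->
  `|x - basis_proj k x| ^+ 2 <= C.
Proof.
move=> hC; have [_ /(_ x) hx] := he.
have cv : (fun n => `|basis_proj n x - basis_proj k x| ^+ 2) @ \oo
    --> `|x - basis_proj k x| ^+ 2.
  have h : (fun n => `|basis_proj n x - basis_proj k x|) @ \oo
      --> `|x - basis_proj k x|.
    by apply: cvg_norm; apply: cvgB => //; exact: cvg_cst.
  by rewrite expr2; under eq_fun do rewrite expr2; exact: cvgM.
rewrite -(cvg_lim _ cv)//; apply: limr_le; first by apply/cvg_ex; eexists; exact: cv.
near=> n.
have kn : (k <= n)%N by near: n; exact: nbhs_infty_ge.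
rewrite /basis_proj (big_cat_nat (leq0n k) kn)//= addrAC subrr add0r.
by rewrite sqr_norm_basis_sum hC.
Unshelve. all: by end_near. Qed.

Lemma sqr_norm_residual_le_series (k : nat) (x : H) :
  ((`|x - basis_proj k x| ^+ 2)%:E <=
   \sum_(k <= i <oo | i \in D) (inner x (e i) ^+ 2)%:E)%E.
Proof.
set s := (\sum_(k <= i <oo | i \in D) _)%E.
have part n : (k <= n)%N ->
    ((\sum_(k <= i < n | i \in D) inner x (e i) ^+ 2)%:E <= s)%E.
  move=> kn; rewrite -sumEFin; apply: nneseries_lim_ge => i _ _.
  by rewrite lee_fin sqr_ge0.
move: part; case: s => [r||].
- move=> h; rewrite lee_fin; apply: sqr_norm_residual_le => n /h.
  by rewrite lee_fin.
- by move=> _; rewrite leey.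
- by move=> /(_ _ (leqnn k)).
Qed.

End orthonormal_expansion.

Lemma basis_proj_setT (R : realType) (H : hilbertType R) (e : nat -> H) n x :
  basis_proj setT e n x = \sum_(i < n) inner x (e i) *: e i.
Proof. by rewrite /basis_proj big_mkord; apply: eq_bigl => i; rewrite in_setT. Qed.

(** * Borel measurability *)

Lemma countable_bigcup_measurable d (T : sigmaRingType d) U (A : set U)
    (F : U -> set T) : countable A -> (forall i, A i -> measurable (F i)) ->
  measurable (\bigcup_(i in A) F i).
Proof.
move=> cA mF; rewrite bigcup_set_type.
apply: countable_bigcupT_measurable; first by rewrite (eq_countable (card_setT _)).
by move=> i; apply: mF; exact: set_valP.
Qed.

Lemma measurable_sum_in d (T : measurableType d) (R : realType) (I : finType)
    (A : pred I) (f : I -> T -> R) : (forall i, measurable_fun setT (f i)) ->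
  measurable_fun setT (fun x => \sum_(i | A i) f i x).
Proof.
move=> mf; under eq_fun do rewrite -big_filter.
exact: measurable_sum.
Qed.

Section borel_measurability.
Context (R : realType).

Lemma borel_open (T : ptopologicalType) (A : set T) :
  open A -> measurable (A : set (borel T)).
Proof. exact: sub_sigma_algebra. Qed.

Lemma borel_continuous_measurable (T U : ptopologicalType) (f : T -> U) :
  continuous f -> measurable_fun setT (f : borel T -> borel U).
Proof.
move=> /continuousP cf.
apply: (@measurability _ _ (borel T) (borel U) setT f (@open U)) => //.
by move=> _ [B oB <-]; rewrite setTI; apply: borel_open; exact: cf.
Qed.

Lemma continuous_borel_realfun (T : ptopologicalType) (f : T -> R) :
  continuous f -> measurable_fun setT (f : borel T -> R).
Proof.
move=> /continuousP cf; apply: (measurability _ (RGenOpens.measurableE R)).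
move=> _ [_ [a [b ->] <-]]; rewrite setTI.
by apply: borel_open; apply: cf; exact: interval_open.
Qed.

Lemma measurable_fun_lt_real d (T : measurableType d) (f : T -> R) :
  (forall r : R, measurable [set x | f x < r]) -> measurable_fun setT f.
Proof.
move=> h; apply: (measurability _ (RGenCInfty.measurableE R)).
move=> _ [_ [r ->] <-]; rewrite setTI.
rewrite (_ : _ @^-1` _ = ~` [set x | f x < r]); first exact: measurableC.
apply/seteqP; split=> x /=; rewrite in_itv/= andbT.
  by move=> rf; apply/negP; rewrite -leNgt.
by move=> /negP; rewrite -leNgt.
Qed.

Lemma measurable_fun_lt_ereal d (T : measurableType d) (f : T -> \bar R) :
  (forall r : R, measurable [set x | (f x < r%:E)%E]) -> measurable_fun setT f.
Proof.
move=> h; apply: (measurability _ (ErealGenCInfty.measurableE R)).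
move=> _ [_ [r ->] <-]; rewrite setTI.
rewrite (_ : _ @^-1` _ = ~` [set x | (f x < r%:E)%E]); first exact: measurableC.
apply/seteqP; split=> x /=; rewrite in_itv/= andbT.
  by move=> rf; apply/negP; rewrite -leNgt.
by move=> /negP; rewrite -leNgt.
Qed.

(** Two points are at distance less than [r] if and only if some point of a
    countable dense set and some rational number witness it. *)
Lemma measurable_dist d (T : measurableType d) (Y : hilbertType R)
    (hY : separable Y) (F G : T -> borel Y) :
  measurable_fun setT F -> measurable_fun setT G ->
  measurable_fun setT (fun x => `|(F x : Y) - G x|).
Proof.
move=> mF mG; have [A [cA dA]] := hY.
have mball (K : T -> borel Y) (q : Y) (s : R) : measurable_fun setT K ->
    measurable [set x | `|(K x : Y) - q| < s].
  move=> mK; rewrite -[X in measurable X]setTI.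
  apply: (mK measurableT [set y : borel Y | `|(y : Y) - q| < s]).
  apply: borel_open.
  rewrite (_ : [set _ | _] = ball q s); first exact: ball_open.
  by apply/seteqP; split => y /=; rewrite -ball_normE/= distrC.
apply: measurable_fun_lt_real => r.
rewrite (_ : [set _ | _] = \bigcup_(q in A) \bigcup_(s : rat)
    ([set x | `|(F x : Y) - q| < r - ratr s]
       `&` [set x | `|(G x : Y) - q| < ratr s])); last first.
  apply/seteqP; split => x /=.
    move=> FGr; pose e := (r - `|(F x : Y) - G x|) / 4.
    have e0 : 0 < e by rewrite divr_gt0// subr_gt0.
    have [q [Aq qG]] : A `&` ball (G x : Y) e !=set0.
      by rewrite setIC; apply: dA; [exists (G x : Y); exact: ballxx|exact: ball_open].
    have [s] : exists s : rat, ratr s \in `]e, (2 * e)[.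
      by apply: rat_in_itvoo; lra.
    rewrite in_itv/= => /andP[es s2e].
    exists q => //; exists s => //; split => /=; last first.
      by rewrite (lt_trans _ es)//; move: qG; rewrite -ball_normE.
    have Fq : `|(F x : Y) - q| <= `|(F x : Y) - G x| + `|(G x : Y) - q|.
      by rewrite (le_trans _ (ler_normD _ _))// addrA subrK.
    move: qG; rewrite -ball_normE/= => qG.
    rewrite (le_lt_trans Fq)//.
    have : `|(F x : Y) - G x| = r - 4 * e.
      by rewrite /e mulrCA divff// mulr1 opprB addrCA subrr addr0.
    by move=> ->; lra.
  move=> [q Aq [s _ [/= h1 h2]]].
  have : `|(F x : Y) - G x| <= `|(F x : Y) - q| + `|(G x : Y) - q|.
    rewrite (distrC (G x : Y)) (le_trans _ (ler_normD _ _))//.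
    by rewrite addrA subrK.
  by move=> /le_lt_trans; apply; rewrite -(subrK (ratr s) r) ltrD.
apply: countable_bigcup_measurable => // q _.
by apply: bigcupT_measurable_rat => s; apply: measurableI; exact: mball.
Qed.

End borel_measurability.

(** * The norm and the distance of Lp *)

Section Lnorm_probability.
Context d (T : measurableType d) (R : realType) (P : probability T R) (p : R).
Hypothesis p1 : 1 <= p.
Implicit Types f g : T -> R.

Let p0 : 0 < p. Proof. exact: lt_le_trans p1. Qed.

Let measurable_powR_norm f : measurable_fun setT f ->
  measurable_fun setT (fun x => (`|(f x)%:E| `^ p)%E).
Proof.
move=> mf; rewrite (_ : (fun _ => _) = EFin \o (fun x => `|f x| `^ p))//.
apply/measurable_EFinP.
apply: (@measurableT_comp _ _ _ _ _ _ (@powR R ^~ p)) => //.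
exact: measurableT_comp.
Qed.

Lemma Lnorm_le f g : measurable_fun setT f -> measurable_fun setT g ->
  (forall x, `|f x| <= `|g x|) ->
  (Lnorm P p%:E (EFin \o f) <= Lnorm P p%:E (EFin \o g))%E.
Proof.
move=> mf mg fg; rewrite unlock.
apply: gt0_ler_poweR; rewrite ?invr_ge0 ?(ltW p0)//.
- by rewrite in_itv/= leey andbT integral_ge0.
- by rewrite in_itv/= leey andbT integral_ge0.
apply: ge0_le_integral => //.
- by move=> x _; rewrite lee_fin powR_ge0.
- exact: measurable_powR_norm.
- exact: measurable_powR_norm.
move=> x _; apply: gt0_ler_poweR; rewrite ?(ltW p0)//= ?in_itv/= ?leey ?andbT//.
by rewrite lee_fin.
Qed.

Lemma L1_le_Lnorm f : measurable_fun setT f ->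
  (\int[P]_x `|f x|%:E <= Lnorm P p%:E (EFin \o f))%E.
Proof.
move=> mf; rewrite -(Lnorm1 P (EFin \o f)).
move: p1; rewrite le_eqVlt => /predU1P[<-//|p_gt1].
have q0 : 0 < p / (p - 1) by rewrite divr_gt0// subr_gt0.
have pq : p^-1 + (p / (p - 1))^-1 = 1.
  by rewrite invf_div; field; rewrite gt_eqF.
have := @hoelder _ _ _ P f (cst 1) p _ mf (measurable_cst _) p0 q0 pq.
rewrite (_ : (f \* cst 1)%R = f); last by apply/funext => x /=; rewrite mulr1.
move=> /le_trans; apply.
rewrite [X in (_ * X)%E](_ : _ = 1%E) ?mule1//.
rewrite Lnorm_cst1 -[RHS](poweR1r (p / (p - 1))^-1).
by congr poweR; exact: probability_setT.
Qed.

Lemma Lnorm_cst (c : R) : 0 <= c -> Lnorm P p%:E (EFin \o cst c) = c%:E.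
Proof.
move=> c0; rewrite unlock.
rewrite (_ : (fun _ => _) = cst (c `^ p)%:E); last first.
  by apply/funext => x /=; rewrite ger0_norm.
rewrite integral_cst// [X in (_ * X)%E](_ : _ = 1%E); last exact: probability_setT.
by rewrite mule1 poweR_EFin -powRrM mulfV ?gt_eqF// powRr1.
Qed.

Lemma Lnorm_indic (A : set T) (c : R) : measurable A -> 0 <= c ->
  Lnorm P p%:E (EFin \o (fun x => c * \1_A x)) = (c%:E * P A `^ p^-1)%E.
Proof.
move=> mA c0; rewrite unlock.
rewrite (eq_integral (fun x => (c `^ p)%:E * (\1_A x)%:E)%E); last first.
  move=> x _ /=; rewrite ger0_norm ?mulr_ge0// powRM// -EFinM; congr (_ * _)%:E.
  rewrite indicE; case: (x \in A); first by rewrite powR1.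
  by rewrite powR0// gt_eqF.
rewrite ge0_integralZl_EFin ?powR_ge0//; last first.
  by apply/measurable_EFinP; exact: measurable_indic.
rewrite integral_indic// setIT poweRM ?lee_fin ?powR_ge0//.
by rewrite poweR_EFin -powRrM mulfV ?gt_eqF// powRr1.
Qed.

(** Separates a uniform error from the error on an exceptional set, whose mass
    enters with the power [1 / p]. *)
Lemma Lnorm_le_off f (A : set T) (c1 c2 : R) : measurable_fun setT f ->
  measurable A -> 0 <= c1 -> 0 <= c2 ->
  (forall x, ~ A x -> `|f x| <= c1) -> (forall x, A x -> `|f x| <= c2) ->
  (Lnorm P p%:E (EFin \o f) <= c1%:E + c2%:E * P A `^ p^-1)%E.
Proof.
move=> mf mA c10 c20 f1 f2.
rewrite -(Lnorm_cst c10) -(Lnorm_indic mA c20).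
have mi : measurable_fun setT (fun x => c2 * \1_A x : R).
  by apply: measurable_funM => //; exact: measurable_indic.
apply: le_trans (minkowski_EFin _ _ mi p1); last exact: measurable_cst.
apply: Lnorm_le => //; first exact: measurable_funD.
move=> x; rewrite [leRHS]ger0_norm/= ?addr_ge0 ?mulr_ge0//.
rewrite indicE; case: (pselect (A x)) => Ax.
  by rewrite mem_set// mulr1 (le_trans (f2 _ Ax))// lerDr.
by rewrite memNset// mulr0 addr0 f1.
Qed.

End Lnorm_probability.

Section Lp_distance.
Context (R : realType) (X Y : hilbertType R) (mu : probability (borel X) R).
Variable p : R.
Hypotheses (p1 : 1 <= p) (hY : separable Y).
Implicit Types F G K : X -> Y.
Notation borel_fun F := (measurable_fun setT ((F : X -> Y) : borel X -> borel Y)).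

Let p0 : 0 < p. Proof. exact: lt_le_trans p1. Qed.

Lemma Lp_dist_sym F G : Lp_dist mu p F G = Lp_dist mu p G F.
Proof. by rewrite /Lp_dist /Lp_norm; under eq_fun do rewrite distrC. Qed.

Lemma Lp_dist_ge0 F G : (0 <= Lp_dist mu p F G)%E.
Proof. exact: Lnorm_ge0. Qed.

Lemma Lp_dist_triangle F G K : borel_fun F -> borel_fun G -> borel_fun K ->
  (Lp_dist mu p F K <= Lp_dist mu p F G + Lp_dist mu p G K)%E.
Proof.
move=> mF mG mK.
have mFG := measurable_dist hY mF mG; have mGK := measurable_dist hY mG mK.
have mFK := measurable_dist hY mF mK.
apply: le_trans (minkowski_EFin _ mFG mGK p1).
apply: Lnorm_le => //; first exact: measurable_funD.
move=> x; rewrite /= normr_id [leRHS]ger0_norm ?addr_ge0//.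
by rewrite (le_trans _ (ler_normD _ _))// addrA subrK.
Qed.

Lemma L1_le_Lp_dist F G : borel_fun F -> borel_fun G ->
  (\int[mu]_x `|F x - G x|%:E <= Lp_dist mu p F G)%E.
Proof.
move=> mF mG; have mFG := measurable_dist hY mF mG.
have := L1_le_Lnorm mu p1 mFG.
by under eq_integral do rewrite normr_id.
Qed.

Lemma Lp_dist_le F G (c : R) : borel_fun F -> borel_fun G ->
  (forall x, `|F x - G x| <= c) -> (Lp_dist mu p F G <= c%:E)%E.
Proof.
move=> mF mG FGc; have c0 : 0 <= c by exact: le_trans (FGc 0).
rewrite -(Lnorm_cst mu p1 c0); apply: Lnorm_le => //.
  exact: measurable_dist.
by move=> x; rewrite normr_id [leRHS]ger0_norm.
Qed.

Lemma bounded_Lp_space G (c : R) : borel_fun G -> (forall x, `|G x| <= c) ->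
  Lp_space mu p G.
Proof.
move=> mG Gc; split => //.
have := @Lp_dist_le G (fun=> 0) c mG (measurable_cst _).
rewrite /Lp_dist (_ : (fun x => G x - 0) = G); last first.
  by apply/funext => x; rewrite subr0.
move=> h; apply: (@le_lt_trans _ _ c%:E); last exact: ltry.
by apply: h => x; rewrite subr0.
Qed.

Lemma Lp_open_ball F (r : R) : borel_fun F ->
  Lp_open mu p [set G | Lp_space mu p G /\ (Lp_dist mu p F G < r%:E)%E].
Proof.
move=> mF; split; first by move=> G [].
move=> G [LG FG].
have fFG : Lp_dist mu p F G \is a fin_num.
  by rewrite ge0_fin_numE ?Lp_dist_ge0// (lt_trans FG)// ltry.
exists (r - fine (Lp_dist mu p F G)).
  by rewrite subr_gt0 -lte_fin fineK.
move=> K LK KG; split => //.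
have [mG _] := LG; have [mK _] := LK.
rewrite (le_lt_trans (Lp_dist_triangle mF mG mK))// (Lp_dist_sym G K).
by rewrite -lteBrDl// -[X in (_ - X)%E]fineK// -EFinB.
Qed.

(** The loss is continuous in the estimate, hence it is a measurable function of
    the data. *)
Lemma measurable_Lp_loss d (Data : measurableType d) (h : Data -> X -> Y)
    d' (T : measurableType d') (o : T -> Data) F :
  estimators Y mu p Data h -> borel_fun F -> measurable_fun setT o ->
  measurable_fun setT (fun w => Lp_dist mu p F (h (o w))).
Proof.
move=> [hL hU] mF mo; apply: measurable_fun_lt_ereal => r.
rewrite -[X in measurable X]setTI.
rewrite (_ : [set x | _] = o @^-1` (h @^-1`
    [set G | Lp_space mu p G /\ (Lp_dist mu p F G < r%:E)%E])); last first.
  by apply/seteqP; split => w /=; [split => //|case].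
by apply: mo => //; apply: hU; exact: Lp_open_ball.
Qed.

End Lp_distance.

(** * The function class and the observations *)

Section smooth_class.
Context (R : realType) (Y : hilbertType R) (D : set nat) (psi : nat -> Y).
Context (w : nat -> R) (t : R).
Hypotheses (hpsi : orthonormal_basis D psi) (hw : forall i, w i = i.+1%:R).
Hypothesis (t0 : 0 < t).

(** The weights increase, so the tail of the expansion beyond [k] carries at
    least the weight of its first index. *)
Lemma weighted_norm_residual (B : R) (y : Y) (k : nat) : 0 < B ->
  (weighted_norm D psi w t y <= B%:E)%E ->
  `|y - basis_proj D psi k y| <= B * k.+1%:R `^ (- t).
Proof.
move=> B0; rewrite /weighted_norm; set S := (\sum_(_ <oo | _) _)%E => hS.
have term0 i : 0 <= w i `^ (2 * t) * `|inner y (psi i)| ^+ 2.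
  by rewrite mulr_ge0 ?powR_ge0 ?sqr_ge0.
have S0 : (0 <= S)%E by apply: nneseries_ge0 => i _ _; rewrite lee_fin.
have SB : (S <= (B ^+ 2)%:E)%E.
  rewrite -[S]poweRe1// -(@mulVf _ (2 : R))// poweRrM.
  apply: (@le_trans _ _ (B%:E `^ 2)%E).
    rewrite gt0_ler_poweR//.
      by rewrite in_itv/= poweR_ge0 leey.
    by rewrite in_itv/= lee_fin ltW// leey.
  by rewrite poweR_EFin powR_mulrn ?(ltW B0).
have kt : 0 < (k.+1%:R : R) `^ (- t) by rewrite powR_gt0.
rewrite -(@ler_pXn2r _ 2) ?nnegrE// ?mulr_ge0 ?(ltW kt) ?(ltW B0)// exprMn.
apply: (sqr_norm_residual_le hpsi) => n kn.
rewrite -ler_pdivrMr ?exprn_gt0// -lee_fin (le_trans _ SB)//.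
apply: (@le_trans _ _ (\sum_(0 <= i < n | i \in D)
    (w i `^ (2 * t) * `|inner y (psi i)| ^+ 2)%:E)%E); last first.
  by apply: nneseries_lim_ge => i _ _; rewrite lee_fin.
rewrite sumEFin lee_fin (big_cat_nat (leq0n k) kn)/= -[leLHS]add0r lerD ?sumr_ge0//.
rewrite mulr_suml [leLHS]big_nat_cond [leRHS]big_nat_cond.
apply: ler_sum => i /andP[/andP[ki _] _].
rewrite real_normK ?num_real// mulrC ler_wpM2r ?sqr_ge0// hw.
rewrite powRN exprVn invrK -powR_mulrn ?powR_ge0// -powRrM mulrC.
by apply: ge0_ler_powR; rewrite ?nnegrE ?ler_nat// mulr_ge0 ?ltW.
Qed.

Lemma weighted_norm_bounded (B : R) (y : Y) : 0 < B ->
  (weighted_norm D psi w t y <= B%:E)%E -> `|y| <= B.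
Proof.
move=> B0 /(weighted_norm_residual 0 B0).
by rewrite /basis_proj big_geq// subr0 powR1 mulr1.
Qed.

Lemma weighted_norm_psi0 (s : R) : D 0%N ->
  weighted_norm D psi w t (s *: psi 0%N) = `|s|%:E.
Proof.
move=> D0; rewrite /weighted_norm nneseries_recl; last 2 first.
- by move=> i _; rewrite lee_fin mulr_ge0 ?powR_ge0 ?sqr_ge0.
- exact: mem_set.
rewrite eseries0 => [|i i0 Di].
  have [ho _] := hpsi.
  rewrite adde0 innerZl ho// eqxx mulr1 hw powR1 mul1r.
  by rewrite poweR_EFin powR12_sqrt ?sqr_ge0// sqrtr_sqr normr_id.
move: Di; rewrite inE => Di; have [ho _] := hpsi.
by rewrite innerZl ho//; case: i i0 {Di} => //= i _; rewrite mulr0 normr0 expr0n mulr0.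
Qed.

Context (X : hilbertType R) (B L : R).
Hypotheses (B0 : 0 < B) (L0 : 0 < L).
Implicit Types F : X -> Y.

Lemma lipschitz_class_continuous F :
  lipschitz_class D psi w t B L F -> continuous F.
Proof.
move=> [_ hL] x; apply/cvgrPdist_lt => e e0; near=> y.
rewrite (le_lt_trans (hL _ _))// mulrC -ltr_pdivlMr//.
by near: y; apply: cvgr_dist_lt => //; rewrite divr_gt0.
Unshelve. all: by end_near. Qed.

Lemma lipschitz_class_measurable F : lipschitz_class D psi w t B L F ->
  measurable_fun setT (F : borel X -> borel Y).
Proof.
by move=> /lipschitz_class_continuous; exact: borel_continuous_measurable.
Qed.

Lemma lipschitz_class_bounded F x :
  lipschitz_class D psi w t B L F -> `|F x| <= B.
Proof. by move=> [hB _]; exact: weighted_norm_bounded. Qed.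

End smooth_class.

Section observations.
Context (R : realType) (X Y : hilbertType R).
Context d (Omega : measurableType d) (E : nat -> Y -> Omega -> R) (sigma : R).
Hypothesis mE : forall i y, measurable_fun setT (E i y).

Lemma measurable_fun_obs d' (T : measurableType d') m (f : T -> obs_space Y m) :
  (forall i y, measurable_fun setT (fun z => f z i y : R)) ->
  measurable_fun setT f.
Proof.
move=> mf.
apply: (@measurability _ _ T (obs_space Y m) setT f (@obs_cylinders R Y m)) => //.
by move=> _ [_ [i [y [C [mC ->]]]] <-]; apply: mf.
Qed.

Lemma measurable_obs_coord m (i : 'I_m) (y : Y) :
  measurable_fun setT (fun o : obs_space Y m => o i y : R).
Proof.
move=> _ C mC; rewrite setTI; apply: sub_sigma_algebra.
by exists i, y, C.
Qed.

Lemma measurable_observations m (F : X -> Y) : continuous F ->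
  measurable_fun setT (fun z : m.-tuple (borel X) * Omega =>
    observations E sigma F z.1 z.2).
Proof.
move=> cF; apply: measurable_fun_obs => i y /=.
apply: measurable_funD.
  have mi : measurable_fun setT (fun x : borel X => inner (F x) y : R).
    apply: continuous_borel_realfun => x.
    by apply: (@continuous_comp _ _ _ F (fun v => inner v y)); [exact: cF|exact: (@continuous_inner R Y y)].
  apply: (measurableT_comp mi).
  exact: (measurableT_comp (measurable_tnth i)).
apply: measurable_funM => //.
exact: (measurableT_comp (mE i y)).
Qed.

Lemma measurable_fixed_observations m (F : X -> Y) (x : m.-tuple (borel X)) :
  measurable_fun setT (fun w => observations E sigma F x w).
Proof.
apply: measurable_fun_obs => i y /=.
by apply: measurable_funD => //; apply: measurable_funM.
Qed.

End observations.

(** * Lower bound: fooling functions *)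

Section averaging.
Context d (T : measurableType d) (R : realType) (P : probability T R).
Local Open Scope ereal_scope.

(** Pairing the indices by an involution that may depend on the sample point:
    if the two losses of a pair add up to at least [c], then some index has
    expected loss at least [c / 2]. *)
Lemma ge_half_of_paired_losses (I : finType) (i0 : I) (l : I -> T -> \bar R)
    (flip : T -> I -> I) (c : R) (M : \bar R) : (0 <= c)%R ->
  (forall i, measurable_fun setT (l i)) -> (forall i z, 0 <= l i z) ->
  (forall z, involutive (flip z)) ->
  (forall z i, c%:E <= l i z + l (flip z i) z) ->
  (forall i, \int[P]_z l i z <= M) -> (c / 2)%:E <= M.
Proof.
move=> c0 ml l0 flipK cl lM.
have card0 : (0 < #|I|%:R :> R)%R by rewrite ltr0n; apply/card_gt0P; exists i0.
have sum_ge z : (#|I|%:R * (c / 2))%:E <= \sum_i l i z.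
  have : (#|I|%:R * c)%:E <= \sum_i l i z + \sum_i l i z.
    rewrite [X in _ <= _ + X](reindex_inj (inv_inj (flipK z)))/= -big_split/=.
    rewrite mulr_natl -sumr_const -sumEFin; apply: lee_sum => i _; exact: cl.
  case: (\sum_i l i z) => [r||]; rewrite ?leey//.
    by rewrite -EFinD !lee_fin; lra.
have M0 : 0 <= M by apply: le_trans (lM i0); exact: integral_ge0.
case: M M0 lM => [r _ lM|_ _|//]; last by rewrite leey.
have : (#|I|%:R * (c / 2))%:E <= (#|I|%:R * r)%:E; last first.
  by rewrite !lee_fin ler_pM2l.
apply: (@le_trans _ _ (\int[P]_z \sum_i l i z)).
  rewrite -[leLHS]mule1 -(@probability_setT _ _ _ P) -integral_cst//.
  apply: ge0_le_integral => //.
  - by move=> z _; rewrite lee_fin mulr_ge0 ?(ltW card0)// divr_ge0.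
  - exact: emeasurable_sum.
rewrite ge0_integral_sum// mulr_natl -sumr_const -sumEFin.
by apply: lee_sum => i _; exact: lM.
Qed.

End averaging.

Section bumps.
Context (R : realType) (X : hilbertType R) (J : finType) (bump : J -> X -> R).
Context (A : R).
Hypotheses (bump_ge0 : forall k x, 0 <= bump k x).
Hypotheses (bump_le : forall k x, bump k x <= A).
Hypotheses (bump_lip : forall k x y, bump k x - bump k y <= `|x - y|).
Hypotheses (bump_disj : forall k l x, bump k x != 0 -> bump l x != 0 -> k = l).
Implicit Types (S U : {set J}).

Definition bump_sum S (x : X) := \sum_(k in S) bump k x.

Lemma bump_sum_at S k x : bump k x != 0 ->
  bump_sum S x = if k \in S then bump k x else 0.
Proof.
move=> kx.
have h l : l != k -> bump l x = 0.
  by apply: contraNeq => lx; rewrite (bump_disj lx kx).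
rewrite /bump_sum; case: ifPn => kS.
  by rewrite (bigD1 k)//= big1 ?addr0// => l /andP[_ /h].
by rewrite big1// => l lS; apply: h; apply: contraNneq kS => <-.
Qed.

Lemma bump_sum_ge0 S x : 0 <= bump_sum S x.
Proof. exact: sumr_ge0. Qed.

Lemma bump_sum_cases S x :
  bump_sum S x = 0 \/ exists2 k, k \in S & bump_sum S x = bump k x.
Proof.
have [/existsP[k /andP[kS kx]]|] := boolP [exists k, (k \in S) && (bump k x != 0)].
  by right; exists k => //; rewrite (bump_sum_at _ kx) kS.
rewrite negb_exists => /forallP h; left; apply: big1 => k kS.
by have := h k; rewrite kS/= negbK => /eqP.
Qed.

Lemma bump_sum_le S x : 0 <= A -> bump_sum S x <= A.
Proof. by move=> A0; case: (bump_sum_cases S x) => [->//|[k _ ->]]. Qed.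

Lemma bump_sum_lipschitz S x y : `|bump_sum S x - bump_sum S y| <= `|x - y|.
Proof.
have half u v : bump_sum S u - bump_sum S v <= `|u - v|.
  case: (bump_sum_cases S u) => [->|[k kS ->]].
    by rewrite sub0r (@le_trans _ _ 0)// oppr_le0 bump_sum_ge0.
  rewrite (le_trans _ (bump_lip k u v))// lerD2l lerN2.
  by rewrite /bump_sum (bigD1 k)//= lerDl sumr_ge0.
by rewrite ler_norml half andbT lerNl opprB distrC half.
Qed.

Definition flip U S : {set J} := [set k | (k \in S) (+) (k \in U)]%SET.

Lemma flipK U : involutive (flip U).
Proof. by move=> S; apply/setP => k; rewrite !inE -addbA addbb addbF. Qed.

Definition unhit m (x : m.-tuple X) : {set J} :=
  [set k | [forall j, bump k (tnth x j) == 0]]%SET.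

(** Each design point is seen by at most one bump. *)
Lemma card_unhit m (x : m.-tuple X) : (#|J| - m <= #|unhit x|)%N.
Proof.
rewrite -(cardsC (unhit x)) leq_subLR addnC leq_add2r.
pose g (j : 'I_m) := [pick k | bump k (tnth x j) != 0].
rewrite -(card_imset (~: unhit x)%SET (@Some_inj _)).
apply: (@leq_trans #|(g @: [set: 'I_m])%SET|); last first.
  by rewrite (leq_trans (leq_imset_card _ _))// cardsT card_ord.
apply: subset_leq_card; apply/fintype.subsetP => _ /imsetP[k + ->].
rewrite !inE negb_forall => /existsP[j kj]; apply/imsetP; exists j => //.
rewrite /g; case: pickP => [l lj|/(_ k)]; last by rewrite kj.
by congr Some; exact: bump_disj kj lj.
Qed.

Lemma bump_sum_flip_unhit m (x : m.-tuple X) S j :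
  bump_sum (flip (unhit x) S) (tnth x j) = bump_sum S (tnth x j).
Proof.
rewrite /bump_sum big_mkcond [RHS]big_mkcond; apply: eq_bigr => k _.
rewrite !inE; case: (boolP [forall j, _]) => [/forallP/(_ j)/eqP ->|_].
  by rewrite !if_same.
by rewrite addbF.
Qed.

Lemma bump_sum_flip_ge S U (C : J -> set X) x : 0 <= A ->
  (forall k x, C k x -> bump k x = A) ->
  A * \sum_(k in U) \1_(C k) x <= `|bump_sum S x - bump_sum (flip U S) x|.
Proof.
rewrite le_eqVlt => /predU1P[<-|A0] hC; first by rewrite mul0r.
have [/existsP[k /andP[kU /asboolP kC]]|] :=
    boolP [exists k, (k \in U) && `[< C k x >]].
  have kx : bump k x != 0 by rewrite hC// gt_eqF.
  rewrite (bigD1 k)//= big1 => [|l /andP[lU lk]]; last first.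
    rewrite indicE memNset// => lC; have lx : bump l x != 0 by rewrite hC// gt_eqF.
    by move: lk; rewrite (bump_disj lx kx) eqxx.
  rewrite indicE mem_set// addr0 mulr1 !(bump_sum_at _ kx) inE kU addbT hC//.
  by case: (k \in S); rewrite /= ?subr0 ?sub0r ?normrN gtr0_norm.
rewrite negb_exists => /forallP h; rewrite big1 ?mulr0// => k kU.
by rewrite indicE memNset//; move/asboolP; have := h k; rewrite kU/= => /negP.
Qed.

End bumps.

Section fooling_risk.
Context (R : realType) (X Y : hilbertType R) (mu : probability (borel X) R).
Context (p : R) (p1 : 1 <= p) (hY : separable Y).
Context (D : set nat) (psi : nat -> Y) (w : nat -> R) (t B L : R).
Hypotheses (hpsi : orthonormal_basis D psi) (hw : forall i, w i = i.+1%:R).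
Hypotheses (D0 : D 0%N) (L0 : 0 < L).
Context (J : finType) (bump : J -> X -> R) (A s q : R) (C : J -> set (borel X)).
Hypotheses (bump_ge0 : forall k x, 0 <= bump k x).
Hypotheses (bump_le : forall k x, bump k x <= A).
Hypotheses (bump_lip : forall k x y, bump k x - bump k y <= `|x - y|).
Hypotheses (bump_disj : forall k l x, bump k x != 0 -> bump l x != 0 -> k = l).
Hypotheses (A0 : 0 <= A) (s0 : 0 <= s) (sL : s <= L) (sAB : s * A <= B).
Hypotheses (q0 : 0 <= q) (mC : forall k, measurable (C k)).
Hypotheses (hC : forall k x, C k x -> bump k x = A).
Hypotheses (muC : forall k, (q%:E <= mu (C k))%E).

Let class := @lipschitz_class R X Y D psi w t B L.

(** [S] ranges over all sets of bumps; the bound comes from averaging over it. *)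
Definition fooling (S : {set J}) (x : X) : Y := (s * bump_sum bump S x) *: psi 0%N.

Lemma fooling_class S : class (fooling S).
Proof.
split=> [x|x y].
  rewrite (weighted_norm_psi0 t hpsi hw)// lee_fin.
  rewrite ger0_norm ?mulr_ge0 ?bump_sum_ge0//.
  by rewrite (le_trans _ sAB)// ler_wpM2l// bump_sum_le.
rewrite -scalerBl normrZ (norm_basis hpsi D0) mulr1 -mulrBr normrM ger0_norm//.
by rewrite ler_pM// bump_sum_lipschitz.
Qed.

Let measurable_fooling S : measurable_fun setT (fooling S : borel X -> borel Y).
Proof. exact: lipschitz_class_measurable L0 _ (fooling_class S). Qed.

Let gap m := s * (A * ((#|J| - m)%:R * q)).

Let gap_ge0 m : 0 <= gap m.
Proof. by rewrite !mulr_ge0. Qed.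

(** The two functions differ by the full height of a bump on the core of each
    unhit cell; the mass of these cores bounds already the L1 distance. *)
Lemma Lp_dist_fooling_flip m (x : m.-tuple X) S :
  ((gap m)%:E <= Lp_dist mu p (fooling S) (fooling (flip (unhit bump x) S)))%E.
Proof.
apply: le_trans (L1_le_Lp_dist _ _ _ _ _) => //.
set U := unhit bump x.
apply: (@le_trans _ _ (\int[mu]_y (s * A * \sum_(k in U) \1_(C k) y)%:E)%E); last first.
  apply: ge0_le_integral => //.
  - by move=> y _; rewrite lee_fin !mulr_ge0 ?sumr_ge0.
  - apply/measurable_EFinP; apply: measurable_funM => //.
    by apply: measurable_sum_in => k; exact: measurable_indic.
  - by apply/measurable_EFinP; exact: measurable_dist.
  move=> y _; rewrite lee_fin -scalerBl normrZ (norm_basis hpsi D0) mulr1 -mulrBr normrM ger0_norm//.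
  by rewrite -mulrA ler_wpM2l// bump_sum_flip_ge.
under eq_integral do rewrite EFinM.
rewrite ge0_integralZl_EFin ?mulr_ge0//; last 2 first.
- by move=> y _; rewrite lee_fin sumr_ge0.
- by apply/measurable_EFinP; apply: measurable_sum_in => k; exact: measurable_indic.
rewrite /gap mulrA EFinM lee_wpmul2l ?lee_fin ?mulr_ge0//.
under eq_integral do rewrite -sumEFin -big_filter.
rewrite ge0_integral_sum//; last first.
  by move=> k; apply/measurable_EFinP; exact: measurable_indic.
rewrite big_filter.
apply: (@le_trans _ _ (\sum_(k in U) q%:E)%E).
  rewrite sumEFin lee_fin sumr_const -[leRHS]mulr_natl ler_wpM2r// ler_nat.
  exact: card_unhit.
by apply: lee_sum => k _; rewrite integral_indic// setIT muC.
Qed.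

Context d (Omega : measurableType d) (P : probability Omega R).
Context (E : nat -> Y -> Omega -> R) (sigma : R).
Hypothesis mE : forall i y, measurable_fun setT (E i y).

(** The flip is invisible at the design points, so that both functions give the
    same data; no estimate is close to both of them. *)
Let paired_losses m (x : m.-tuple (borel X)) om
    (h : obs_space Y m -> X -> Y) S :
  (forall z, Lp_space mu p (h z)) ->
  ((gap m)%:E <=
     Lp_dist mu p (fooling S) (h (observations E sigma (fooling S) x om)) +
     let S' := flip (unhit bump x) S in
     Lp_dist mu p (fooling S') (h (observations E sigma (fooling S') x om)))%E.
Proof.
move=> hL /=; set S' := flip _ _.
have -> : observations E sigma (fooling S') x om
    = observations E sigma (fooling S) x om.
  apply/funext => j; apply/funext => y.
  by rewrite /observations /fooling bump_sum_flip_unhit.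
apply: le_trans (Lp_dist_fooling_flip x S) _.
have [mh _] := hL (observations E sigma (fooling S) x om).
rewrite (Lp_dist_sym _ _ (fooling S')).
exact: Lp_dist_triangle.
Qed.

Lemma fixed_design_risk_ge_gap m :
  ((gap m / 2)%:E <= fixed_design_risk mu P E sigma p class m)%E.
Proof.
apply: le_ereal_inf_tmp => _ [x _ <-]; apply: le_ereal_inf_tmp => _ [h hh <-].
apply: (@ge_half_of_paired_losses _ _ _ P {set J} finset.set0
  (fun S om => Lp_dist mu p (fooling S) (h (observations E sigma (fooling S) x om)))
  (fun _ => flip (unhit bump x))) => //.
- move=> S; apply: (measurable_Lp_loss p1 hY hh) => //.
  exact: measurable_fixed_observations.
- by move=> S om; exact: Lp_dist_ge0.
- by move=> _; exact: flipK.
- by move=> om S; apply: paired_losses; case: hh.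
by move=> S; apply: ereal_sup_ubound; exists (fooling S) => //; exact: fooling_class.
Qed.

Lemma random_design_risk_ge_gap m :
  ((gap m / 2)%:E <= random_design_risk mu P E sigma p class m)%E.
Proof.
apply: le_ereal_inf_tmp => _ [nu _ <-]; apply: le_ereal_inf_tmp => _ [h hh <-].
apply: (@ge_half_of_paired_losses _ _ _ (iid_law nu m \x P)%E {set J} finset.set0
  (fun S z => Lp_dist mu p (fooling S)
     (h (z.1, observations E sigma (fooling S) z.1 z.2)))
  (fun z => flip (unhit bump z.1))) => //.
- move=> S.
  apply: (measurable_Lp_loss p1 hY (o := fun z => (z.1, observations E sigma (fooling S) z.1 z.2)) hh) => //.
  apply: measurable_fun_pair => //.
  by apply: measurable_observations => //; exact: lipschitz_class_continuous (fooling_class S).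
- by move=> S om; exact: Lp_dist_ge0.
- by move=> z; exact: flipK.
- by move=> z S; apply: (@paired_losses _ z.1 z.2 (fun o => h (z.1, o))) => o; case: hh.
by move=> S; apply: ereal_sup_ubound; exists (fooling S) => //; exact: fooling_class.
Qed.

End fooling_risk.

(** * Lower bound: bumps on a grid *)

Section grid_bumps.
Context (R : realType) (X : hilbertType R) (mu : probability (borel X) R).
Context (lambda : nat -> R) (phi : nat -> X) (a b : R) (d N : nat).
Hypotheses (lambda0 : forall i, 0 < lambda i).
Hypotheses (lambda_noninc : {homo lambda : i j / (i <= j)%N >-> j <= i}).
Hypotheses (hphi : orthonormal_basis setT phi) (a0 : 0 < a) (b0 : 0 < b).
Hypotheses (indep : independent_rvs mu (kl_coord lambda phi)).
Hypotheses (dens : small_ball_density mu (kl_coord lambda phi) a b).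

Local Notation xi := (kl_coord lambda phi).
Local Notation sd i := (Num.sqrt (lambda i)).

(** The box [-a, a]^(d+1) of the normalized coordinates is cut into (N+1)^(d+1)
    equal cells; [k] lists the position of a cell along each axis. *)
Definition cell := {ffun 'I_d.+1 -> 'I_N.+1}.

Definition node (j : nat) : R := a * ((2 * j%:R + 1) / N.+1%:R - 1).

Definition half_width : R := a / N.+1%:R.

Definition cell_margin (k : cell) (i : 'I_d.+1) (x : X) : R :=
  sd i * (half_width - `|xi i x - node (k i)|).

Definition bump_height : R := sd d * half_width / 2.

(** A truncated distance to the boundary of the cell, in the metric of the
    Hilbert space. The cell is narrowest along the last axis, so that half its
    width there is a height that is reached at the core of the cell. *)
Definition grid_bump (k : cell) (x : X) : R :=
  Num.max 0 (\big[Num.min/bump_height]_(i < d.+1) cell_margin k i x).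

Definition cell_core (k : cell) : set (borel X) :=
  [set x | forall i : 'I_d.+1, `|xi i x - node (k i)| <= half_width / 2].

Let sd_gt0 i : 0 < sd i. Proof. by rewrite sqrtr_gt0. Qed.

Let half_width_gt0 : 0 < half_width. Proof. by rewrite divr_gt0. Qed.

Let bump_height_gt0 : 0 < bump_height.
Proof. by rewrite divr_gt0// mulr_gt0. Qed.

Lemma grid_bump_ge0 k x : 0 <= grid_bump k x.
Proof. by rewrite le_max lexx. Qed.

Lemma grid_bump_le k x : grid_bump k x <= bump_height.
Proof. by rewrite ge_max (ltW bump_height_gt0) bigmin_le_id. Qed.

Lemma kl_coord_lipschitz i x y : sd i * `|xi i x - xi i y| <= `|x - y|.
Proof.
rewrite /kl_coord -mulrBl normrM normfV (gtr0_norm (sd_gt0 i)).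
rewrite mulrC divfK ?gt_eqF// -innerBl (le_trans (cauchy_schwarz _ _))//.
by rewrite (norm_basis hphi)// mulr1.
Qed.

Lemma grid_bump_lipschitz k x y : grid_bump k x - grid_bump k y <= `|x - y|.
Proof.
rewrite lerBlDl {1}/grid_bump ge_max addr_ge0 ?grid_bump_ge0//=.
rewrite -lerBlDr /grid_bump le_max; apply/orP; right.
apply/bigmin_geP; split.
  by rewrite lerBlDr (le_trans (bigmin_le_id _ _ _ _))// lerDl.
move=> i _; rewrite lerBlDr (le_trans (bigmin_le _ i _))//.
rewrite /cell_margin -lerBlDl -mulrBr (le_trans _ (kl_coord_lipschitz i x y))//.
rewrite ler_wpM2l ?(ltW (sd_gt0 _))//.
set u := xi i x; set v := xi i y; set n := node _.
by have := ler_distD u v n; rewrite (distrC v u); lra.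
Qed.

Lemma grid_bump_supp k x : grid_bump k x != 0 ->
  forall i : 'I_d.+1, `|xi i x - node (k i)| < half_width.
Proof.
move=> kx i; have : 0 < grid_bump k x by rewrite lt_neqAle eq_sym kx grid_bump_ge0.
rewrite lt_max ltxx/= => /bigmin_gtP[_ /(_ i isT)].
by rewrite /cell_margin pmulr_rgt0// subr_gt0.
Qed.

Lemma grid_bump_disj k l x : grid_bump k x != 0 -> grid_bump l x != 0 -> k = l.
Proof.
move=> /grid_bump_supp kx /grid_bump_supp lx; apply/ffunP => i; apply: val_inj => /=.
have : `|node (k i) - node (l i)| < 2 * half_width.
  have := kx i; have := lx i; have := ler_distD (xi i x) (node (k i)) (node (l i)).
  by rewrite (distrC (node (k i)) (xi i x)); lra.
have -> : node (k i) - node (l i) = 2 * half_width * ((k i)%:R - (l i)%:R).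
  by rewrite /node /half_width; field.
rewrite normrM gtr0_norm ?mulr_gt0// gtr_pMr ?mulr_gt0// => h.
have : `|(Posz (k i) - Posz (l i))%:~R : R| < 1 by rewrite intrB.
by rewrite -intr_norm (_ : 1 = 1%:~R)// ltr_int ltr_norml => /andP[]; lia.
Qed.

Lemma grid_bump_core k x : cell_core k x -> grid_bump k x = bump_height.
Proof.
move=> kx; rewrite /grid_bump bigmin_eq_id ?max_r ?(ltW bump_height_gt0)//.
move=> i _; rewrite /bump_height /cell_margin -mulrA ler_pM//.
- by rewrite divr_ge0 ?ltW.
- by apply: ler_wsqrtr; apply: lambda_noninc; rewrite -ltnS.
by have := kx i; lra.
Qed.

Let core_itv (k : cell) (i : nat) : set R :=
  `[node (k (inord i)) - half_width / 2, node (k (inord i)) + half_width / 2].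

Let cell_coreE k : cell_core k =
  \bigcap_(i in [set` iota 0 d.+1]) (xi i @^-1` core_itv k i).
Proof.
have memP i : [set` iota 0 d.+1] i <-> (i < d.+1)%N.
  change (i \in iota 0 d.+1 <-> (i < d.+1)%N).
  by rewrite mem_iota add0n.
apply/seteqP; split => x h i.
  move=> /memP id.
  have := h (Ordinal id); rewrite ler_distl /core_itv /= in_itv/=.
  suff -> : inord i = Ordinal id by [].
  by apply: ord_inj; rewrite inordK.
have : core_itv k i (xi i x) by apply: h; exact/memP.
by rewrite /core_itv/= in_itv/= inord_val ler_distl.
Qed.

Lemma measurable_kl_coord i : measurable_fun setT (xi i).
Proof.
apply: measurable_funM => //.
by apply: continuous_borel_realfun; exact: continuous_inner.
Qed.

Lemma measurable_cell_core k : measurable (cell_core k).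
Proof.
rewrite cell_coreE; apply: bigcap_measurableType => i _.
by rewrite -[X in measurable X]setTI; apply: measurable_kl_coord => //; exact: measurable_itv.
Qed.

Let core_itv_small k i y : core_itv k i y -> `|y| <= a.
Proof.
rewrite /core_itv/= in_itv/= => /andP[h1 h2].
have kN : ((k (inord i)).+1%:R : R) <= N.+1%:R by rewrite ler_nat.
have n0 : 0 < N.+1%:R :> R by [].
have e1 : node (k (inord i)) = 2 * ((k (inord i))%:R * half_width) + half_width - a.
  by rewrite /node /half_width; field; rewrite gt_eqF.
have e2 : N.+1%:R * half_width = a by rewrite /half_width mulrC divfK// gt_eqF.
have k0 : 0 <= (k (inord i))%:R * half_width by rewrite mulr_ge0 ?(ltW half_width_gt0).
have k1 : (k (inord i))%:R * half_width + half_width <= a.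
  rewrite -[leRHS]e2 -[X in _ + X <= _]mul1r -mulrDl ler_wpM2r ?(ltW half_width_gt0)//.
  by rewrite natr1.
by rewrite ler_norml; apply/andP; split; lra.
Qed.

(** Independence turns the mass of a core into a product over the axes, and each
    factor is at least [b] times the length of the interval. *)
Lemma mu_cell_core k :
  (((2 * a * b / (2 * N.+1%:R)) ^+ d.+1)%:E <= mu (cell_core k))%E.
Proof.
rewrite cell_coreE indep ?iota_uniq//; last first.
  by move=> i _; exists (core_itv k i); [exact: measurable_itv|rewrite setTI].
have [nu [hnu nub]] := dens.
have one i : ((2 * a * b / (2 * N.+1%:R))%:E <= mu (xi i @^-1` core_itv k i))%E.
  have [mnu nu0 ->] := hnu i; last exact: measurable_itv.
  apply: (@le_trans _ _ (\int[lebesgue_measure]_(x in core_itv k i) (cst b%:E x))%E).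
    rewrite integral_cst; last exact: measurable_itv.
    rewrite [X in (_ * X)%E](_ : _ = half_width%:E); last first.
      rewrite [LHS]lebesgue_measure_itv/= lte_fin ifT; last first.
        by rewrite ltrD2l (@lt_trans _ _ 0)// ?oppr_lt0 divr_gt0.
      by rewrite -EFinB; congr EFin; lra.
    rewrite -EFinM lee_fin /half_width.
    by rewrite le_eqVlt; apply/orP; left; apply/eqP; field.
  apply: ge0_le_integral => //.
  - exact: measurable_itv.
  - by move=> x _; rewrite /cst lee_fin ltW.
  - apply/measurable_EFinP.
    exact: measurable_funTS.
  - by move=> x hx; rewrite lee_fin nub// (core_itv_small hx).
have c0 : 0 <= 2 * a * b / (2 * N.+1%:R).
  by rewrite divr_ge0 ?mulr_ge0// ltW.
rewrite -[X in (_ ^+ X)%:E](size_iota 0 d.+1).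
elim: (iota 0 d.+1) => [|i s IH]; first by rewrite big_nil expr0.
by rewrite big_cons/= exprS EFinM lee_pmul// lee_fin ?exprn_ge0.
Qed.

End grid_bumps.

Section lower_bound.
Context (R : realType) (X Y : hilbertType R) (mu : probability (borel X) R).
Context (p : R) (p1 : 1 <= p) (hY : separable Y).
Context (D : set nat) (psi : nat -> Y) (w : nat -> R) (t B L : R).
Hypotheses (hpsi : orthonormal_basis D psi) (hw : forall i, w i = i.+1%:R).
Hypotheses (D0 : D 0%N) (L0 : 0 < L) (B0 : 0 < B).
Context (lambda : nat -> R) (phi : nat -> X) (a b : R).
Hypotheses (lambda0 : forall i, 0 < lambda i).
Hypotheses (lambda_noninc : {homo lambda : i j / (i <= j)%N >-> j <= i}).
Hypotheses (hphi : orthonormal_basis setT phi) (a0 : 0 < a) (b0 : 0 < b).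
Hypotheses (indep : independent_rvs mu (kl_coord lambda phi)).
Hypotheses (dens : small_ball_density mu (kl_coord lambda phi) a b).
Context d (Omega : measurableType d) (P : probability Omega R).
Context (E : nat -> Y -> Omega -> R) (sigma : R).
Hypothesis mE : forall i y, measurable_fun setT (E i y).

Let class := @lipschitz_class R X Y D psi w t B L.

(** The amplitude of the fooling functions: it keeps both the Lipschitz constant
    and the sup norm below the bounds of the class, for every grid. *)
Definition amplitude : R := Num.min L (B / (Num.sqrt (lambda 0%N) * a)).

Lemma amplitude_gt0 : 0 < amplitude.
Proof. by rewrite lt_min L0 divr_gt0// mulr_gt0// sqrtr_gt0. Qed.

(** A quarter of the amplitude, times the height of the bumps, times the total mass
    [(a * b) ^+ n.+1] of the cores of all the cells. *)
Definition grid_risk (n N : nat) : R :=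
  amplitude * (Num.sqrt (lambda n) * a / (8 * N.+1%:R)) * (a * b) ^+ n.+1.

Let sd_gt0 i : 0 < Num.sqrt (lambda i). Proof. by rewrite sqrtr_gt0. Qed.

Let amplitude_bump n N : amplitude * bump_height lambda a n N <= B.
Proof.
rewrite /amplitude (@le_trans _ _ (B / (Num.sqrt (lambda 0%N) * a) * (Num.sqrt (lambda 0%N) * a)))//; last first.
  by rewrite divfK// mulf_neq0// gt_eqF.
rewrite ler_pM//.
- exact/ltW/amplitude_gt0.
- by rewrite /bump_height /half_width !(mulr_ge0, divr_ge0)// ltW.
- by rewrite ge_min lexx orbT.
rewrite /bump_height -mulrA ler_pM//.
- by rewrite /half_width !(mulr_ge0, divr_ge0)// ltW.
- by apply: ler_wsqrtr; exact: lambda_noninc.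
rewrite /half_width -mulrA ler_piMr ?(ltW a0)// -invfM invf_le1 ?mulr_gt0//.
by rewrite -natrM ler1n.
Qed.

Let grid_risk_le_gap n N m : (2 * m <= N.+1 ^ n.+1)%N ->
  grid_risk n N <=
  amplitude * (bump_height lambda a n N *
    ((#|cell n N| - m)%:R * (2 * a * b / (2 * N.+1%:R)) ^+ n.+1)) / 2.
Proof.
move=> mK.
have -> : #|cell n N| = (N.+1 ^ n.+1)%N by rewrite card_ffun !card_ord.
set K := (N.+1 ^ n.+1)%N in mK *.
have K2 : K%:R / 2 <= (K - m)%:R :> R.
  rewrite natrB; last by lia.
  have : (2 * m)%:R <= K%:R :> R by rewrite ler_nat.
  by rewrite natrM; lra.
have N0 : N.+1%:R != 0 :> R by [].
set A := bump_height lambda a n N.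
have -> : grid_risk n N = amplitude * A / 2 *
    (K%:R / 2 * (2 * a * b / (2 * N.+1%:R)) ^+ n.+1).
  rewrite (_ : 2 * a * b / (2 * N.+1%:R) = a * b / N.+1%:R); last by field.
  rewrite exprMn exprVn /K natrX /grid_risk /A /bump_height /half_width.
  have y0 : (N.+1%:R : R) ^+ n.+1 != 0 by rewrite expf_neq0.
  by field; rewrite y0 nat1r N0.
rewrite [leRHS](_ : _ = amplitude * A / 2 *
    ((K - m)%:R * (2 * a * b / (2 * N.+1%:R)) ^+ n.+1)); last by field.
rewrite ler_wpM2l//.
  by rewrite divr_ge0// mulr_ge0 ?(ltW amplitude_gt0)//
             /A /bump_height /half_width !(mulr_ge0, divr_ge0)// ltW.
by rewrite ler_wpM2r// exprn_ge0// divr_ge0// !mulr_ge0// ltW.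
Qed.

Let bump_height_ge0 n N : 0 <= bump_height lambda a n N.
Proof. by rewrite /bump_height /half_width !(mulr_ge0, divr_ge0)// ltW. Qed.

Let amplitude_le : amplitude <= L.
Proof. by rewrite ge_min lexx. Qed.

Let core_mass_ge0 n N : 0 <= (2 * a * b / (2 * N.+1%:R)) ^+ n.+1.
Proof. by rewrite exprn_ge0// divr_ge0// !mulr_ge0// ltW. Qed.

(** At least half of the cells are unhit as soon as there are [2 * m] of them. *)
Lemma fixed_design_risk_ge_grid n N m : (2 * m <= N.+1 ^ n.+1)%N ->
  ((grid_risk n N)%:E <= fixed_design_risk mu P E sigma p class m)%E.
Proof.
move=> mK; have := fixed_design_risk_ge_gap p1 hY t hpsi hw D0 L0
  (@grid_bump_ge0 _ _ lambda phi a n N) (@grid_bump_le _ _ lambda phi a n N lambda0 a0)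
  (@grid_bump_lipschitz _ _ lambda phi a n N lambda0 hphi)
  (@grid_bump_disj _ _ lambda phi a b n N lambda0 a0 b0)
  (bump_height_ge0 n N) (ltW amplitude_gt0) amplitude_le (amplitude_bump n N)
  (core_mass_ge0 n N) (@measurable_cell_core _ _ lambda phi a n N)
  (@grid_bump_core _ _ lambda phi a n N lambda0 lambda_noninc a0)
  (@mu_cell_core _ _ mu lambda phi a b n N a0 b0 indep dens) P sigma mE m.
by apply: le_trans; rewrite lee_fin grid_risk_le_gap.
Qed.

Lemma random_design_risk_ge_grid n N m : (2 * m <= N.+1 ^ n.+1)%N ->
  ((grid_risk n N)%:E <= random_design_risk mu P E sigma p class m)%E.
Proof.
move=> mK; have := random_design_risk_ge_gap p1 hY t hpsi hw D0 L0
  (@grid_bump_ge0 _ _ lambda phi a n N) (@grid_bump_le _ _ lambda phi a n N lambda0 a0)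
  (@grid_bump_lipschitz _ _ lambda phi a n N lambda0 hphi)
  (@grid_bump_disj _ _ lambda phi a b n N lambda0 a0 b0)
  (bump_height_ge0 n N) (ltW amplitude_gt0) amplitude_le (amplitude_bump n N)
  (core_mass_ge0 n N) (@measurable_cell_core _ _ lambda phi a n N)
  (@grid_bump_core _ _ lambda phi a n N lambda0 lambda_noninc a0)
  (@mu_cell_core _ _ mu lambda phi a b n N a0 b0 indep dens) P sigma mE m.
by apply: le_trans; rewrite lee_fin grid_risk_le_gap.
Qed.

End lower_bound.

(** * From exponential bounds on a grid of dimensions to the logarithmic rate *)

Section logarithmic_rate.
Context (R : realType) (omega sigma c0 C : R) (f : nat -> \bar R).
Hypotheses (omega1 : 1 <= omega) (sigma0 : 0 < sigma) (c0_gt0 : 0 < c0).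
Hypotheses (C_gt0 : 0 < C).

Let theta := omega / (omega + 1).
Let rate m := (ln (m%:R / sigma ^+ 2) `^ theta)%:E.

Let omega_gt0 : 0 < omega. Proof. exact: lt_le_trans omega1. Qed.
Let omegaD1_gt0 : 0 < omega + 1. Proof. by rewrite addr_gt0. Qed.
Let theta_gt0 : 0 < theta. Proof. by rewrite divr_gt0. Qed.
Let theta_le1 : theta <= 1.
Proof. by rewrite ler_pdivrMr// mul1r lerDl. Qed.

Lemma near_ln_ge (M : R) : \forall m \near \oo, M <= ln (m%:R : R).
Proof.
exists (Num.truncn (expR M)).+1 => //= m Mm.
have m0 : 0 < (m%:R : R) by rewrite ltr0n; exact: leq_trans Mm.
rewrite -[M]expRK ler_ln ?posrE ?expR_gt0//.
by rewrite (le_trans (ltW (truncnS_gt _)))// ler_nat.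
Qed.

Let ln_rate m : (0 < m)%N -> ln (m%:R / sigma ^+ 2) = ln m%:R - ln (sigma ^+ 2).
Proof. by move=> m0; rewrite ln_div// posrE ?ltr0n ?exprn_gt0. Qed.

(** The real solution [y] of [y * y `^ omega = v]. *)
Let root (v : R) := v `^ (omega + 1)^-1.

Let root_ge0 v : 0 <= root v. Proof. exact: powR_ge0. Qed.

Let rootK v : 0 <= v -> root v * root v `^ omega = v.
Proof.
move=> v0; rewrite -{1}[root v]powRr1// -powRD; last first.
  by apply/implyP; rewrite addrC gt_eqF.
by rewrite /root -powRrM [1 + _]addrC mulVf ?powRr1// gt_eqF.
Qed.

Let root_powR v : root v `^ omega = v `^ theta.
Proof. by rewrite /root -powRrM mulrC. Qed.

Let powR_le (x y s : R) : 0 <= x -> 0 < s -> x <= y -> x `^ s <= y `^ s.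
Proof.
move=> x0 s0 xy; apply: ge0_ler_powR; rewrite ?nnegrE ?(ltW s0)//.
exact: le_trans xy.
Qed.

Let root_ge1 v : 1 <= v -> 1 <= root v.
Proof.
move=> v1; have := @powR_le 1 v (omega + 1)^-1 ler01.
by rewrite powR1; apply => //; rewrite invr_gt0.
Qed.

Let two_powR : 0 < (2 : R) `^ omega. Proof. exact: powR_gt0. Qed.

Let near_powR_ge (M : R) : 0 <= M -> \forall m \near \oo, M <= ln (m%:R : R) `^ theta.
Proof.
move=> M0; near=> m; have lnm : M `^ theta^-1 <= ln (m%:R : R).
  by near: m; exact: near_ln_ge.
rewrite -[leLHS]powRr1// -[X in M `^ X](@mulVf _ theta) ?gt_eqF// powRrM.
by apply: powR_le => //; exact: powR_ge0.
Unshelve. all: by end_near. Qed.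

(** The dimension that the sample size can just not resolve is the integer
    above the root of the logarithm of that size. *)
Lemma lesssim_neg_ln_of_ge :
  (forall n m, (1 <= n)%N -> (2 * m)%:R <= expR (n%:R * n%:R `^ omega) :> R ->
     ((c0 * expR (- (C * n%:R `^ omega)))%:E <= f m)%E) ->
  lesssim (2 * (C * 2 `^ omega + 1)) (fun m => - lne (f m))%E rate.
Proof.
move=> hf; near=> m.
have m0 : (0 < m)%N by near: m; exists 1%N.
have lnm1 : 1 <= ln (m%:R : R) by near: m; exact: near_ln_ge.
have lnmc : `|ln c0| <= ln (m%:R : R) `^ theta.
  by near: m; apply: near_powR_ge.
have lnms : ln 2 + 2 * ln (sigma ^+ 2) <= ln (m%:R : R).
  by near: m; exact: near_ln_ge.
pose v : R := ln (2 * m)%:R.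
have vE : v = ln 2 + ln m%:R by rewrite /v natrM lnM// posrE ltr0n.
have ln2 : 0 <= ln (2 : R) by rewrite ln_ge0// ler1n.
have v1 : 1 <= v by rewrite vE; lra.
have v0 : 0 <= v by exact: le_trans v1.
pose n := (Num.truncn (root v)).+1.
have vn : root v <= n%:R by rewrite ltW// truncnS_gt.
have n2v : n%:R <= 2 * root v.
  have r1 := root_ge1 v1.
  have := truncn_le (root v); rewrite root_ge0 => h.
  by rewrite /n -natr1; lra.
have nv : v <= n%:R * n%:R `^ omega.
  by rewrite -{1}(rootK v0) ler_pM ?powR_ge0// powR_le.
have nV : n%:R `^ omega <= 2 `^ omega * v `^ theta.
  by rewrite -root_powR -powRM// powR_le.
have {}hf : ((c0 * expR (- (C * n%:R `^ omega)))%:E <= f m)%E.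
  apply: hf => //; rewrite -[leLHS]lnK ?ler_expR//.
  by rewrite posrE ltr0n muln_gt0.
have Vr : v `^ theta <= 2 * ln (m%:R / sigma ^+ 2) `^ theta.
  rewrite ln_rate//.
  have r0 : 0 <= ln m%:R - ln (sigma ^+ 2).
    have [s0|s0] := lerP 0 (ln (sigma ^+ 2)); last by lra.
    by lra.
  apply: (@le_trans _ _ ((2 * (ln m%:R - ln (sigma ^+ 2))) `^ theta)).
    by apply: powR_le => //; rewrite vE; lra.
  rewrite powRM// ler_wpM2r ?powR_ge0//.
  by rewrite -[leRHS]powRr1// ler_powR// ler1n.
have Vc : `|ln c0| <= v `^ theta.
  by rewrite (le_trans lnmc)// powR_le// ?vE; lra.
have e0 : 0 < c0 * expR (- (C * n%:R `^ omega)) by rewrite mulr_gt0// expR_gt0.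
apply: (@le_trans _ _ (- lne (c0 * expR (- (C * n%:R `^ omega)))%:E)%E).
  rewrite leeN2 lee_lne// in_itv/= leey andbT.
    by rewrite lee_fin ltW.
  by rewrite (le_trans _ hf)// lee_fin ltW.
rewrite lne_EFin// lnM ?posrE ?expR_gt0// expRK -EFinN /rate -EFinM lee_fin.
rewrite opprD opprK.
have := ler_norm (- ln c0); rewrite normrN => h1.
have h2 : C * n%:R `^ omega <= C * 2 `^ omega * v `^ theta.
  by rewrite -mulrA ler_pM2l.
have h3 : (C * 2 `^ omega + 1) * v `^ theta
    <= (C * 2 `^ omega + 1) * (2 * ln (m%:R / sigma ^+ 2) `^ theta).
  by rewrite ler_wpM2l// addr_ge0// mulr_ge0// ltW.
by lra.
Unshelve. all: by end_near. Qed.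

(** Conversely the dimension that the sample size can resolve is the integer
    below the root of a multiple of its logarithm. *)
Lemma lesssim_rate_of_le (A : R) : 0 < A ->
  (forall n m, (1 <= n)%N -> expR (A * (n%:R * n%:R `^ omega)) <= m%:R :> R ->
     (f m <= (c0 * expR (- (C * n%:R `^ omega)))%:E)%E) ->
  lesssim (2 * 2 `^ omega * (2 * A) `^ theta / C) rate (fun m => - lne (f m))%E.
Proof.
move=> A0 hf; near=> m.
have m0 : (0 < m)%N by near: m; exists 1%N.
have lnmA : A <= ln (m%:R : R) by near: m; exact: near_ln_ge.
have lnmc : 2 * 2 `^ omega * A `^ theta / C * `|ln c0| <= ln (m%:R : R) `^ theta.
  by near: m; apply: near_powR_ge; rewrite !(mulr_ge0, invr_ge0, powR_ge0)// ltW.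
have lnms : - ln (sigma ^+ 2) <= ln (m%:R : R).
  by near: m; exact: near_ln_ge.
have lnms' : ln (sigma ^+ 2) <= ln (m%:R : R).
  by near: m; exact: near_ln_ge.
pose v : R := ln m%:R / A.
have v1 : 1 <= v by rewrite ler_pdivlMr// mul1r.
have v0 : 0 <= v by exact: le_trans v1.
pose n := Num.truncn (root v).
have r1 := root_ge1 v1.
have nv' : n%:R <= root v by rewrite truncn_le.
have n1 : (1 <= n)%N by rewrite truncn_gt0.
have v2n : root v <= 2 * n%:R.
  have := truncnS_gt (root v); rewrite -natr1 -/n => h.
  have : (1 : R) <= n%:R by rewrite ler1n.
  by lra.
have nv : n%:R * n%:R `^ omega <= v.
  by rewrite -[leRHS](rootK v0) ler_pM ?powR_ge0// powR_le.
have nV : v `^ theta <= 2 `^ omega * n%:R `^ omega.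
  by rewrite -root_powR -powRM// powR_le.
have {}hf : (f m <= (c0 * expR (- (C * n%:R `^ omega)))%:E)%E.
  apply: hf => //; rewrite -[leRHS]lnK ?posrE ?ltr0n// ler_expR.
  by rewrite mulrC -ler_pdivlMr.
have e0 : 0 < c0 * expR (- (C * n%:R `^ omega)) by rewrite mulr_gt0// expR_gt0.
have vA : ln (m%:R : R) `^ theta = A `^ theta * v `^ theta.
  by rewrite -powRM ?(ltW A0)// /v mulrC divfK// gt_eqF.
have rV : ln (m%:R / sigma ^+ 2) `^ theta <= (2 * A) `^ theta * v `^ theta.
  rewrite ln_rate// -powRM ?v0 ?(mulr_ge0 _ (ltW A0))//.
  apply: powR_le => //; first by rewrite subr_ge0.
  by rewrite -mulrA [A * v]mulrC divfK ?gt_eqF//; lra.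
have fc : ((C * n%:R `^ omega - ln c0)%:E <= - lne (f m))%E.
  have [f0|f0] := leP (f m) 0%E; first by rewrite le0_lneNy// leey.
  apply: (@le_trans _ _ (- lne (c0 * expR (- (C * n%:R `^ omega)))%:E)%E).
    rewrite lne_EFin// lnM ?posrE ?expR_gt0// expRK -EFinN lee_fin; lra.
  rewrite leeN2 lee_lne// in_itv/= leey andbT//.
    exact: ltW.
  by rewrite lee_fin ltW.
set K := 2 * 2 `^ omega * (2 * A) `^ theta / C.
have K0 : 0 <= K by rewrite !(mulr_ge0, invr_ge0, powR_ge0)// ltW.
apply: (@le_trans _ _ (K%:E * (C * n%:R `^ omega - ln c0)%:E)%E); last first.
  by rewrite lee_wpmul2l.
rewrite /rate -EFinM lee_fin (le_trans rV)// /K.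
have h1 := ler_norm (ln c0).
have h2 : 2 `^ omega * `|ln c0| * 2 <= C * v `^ theta.
  move: lnmc; rewrite vA => h.
  have := h; rewrite [X in X <= _](_ : _ = A `^ theta * (2 `^ omega * `|ln c0| * 2 / C)); last by field; rewrite gt_eqF.
  by rewrite ler_pM2l ?powR_gt0// ler_pdivrMr// [X in _ <= X]mulrC.
have h3 : v `^ theta * C <= 2 * 2 `^ omega * (C * n%:R `^ omega - ln c0).
  have h4 : C * v `^ theta <= C * (2 `^ omega * n%:R `^ omega) by rewrite ler_pM2l.
  have h5 : 2 `^ omega * ln c0 <= 2 `^ omega * `|ln c0| by rewrite ler_pM2l.
  by lra.
rewrite [leRHS](_ : _ = (2 * A) `^ theta *
    (2 * 2 `^ omega * (C * n%:R `^ omega - ln c0) / C)); last by ring.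
by rewrite ler_wpM2l ?powR_ge0// ler_pdivlMr.
Unshelve. all: by end_near. Qed.

End logarithmic_rate.

(** * White noise *)

Section independent_symmetric.
Context d (T : measurableType d) (R : realType) (P : probability T R).
Implicit Types X Z : T -> R.

Definition mk_rv X (mX : measurable_fun setT X) : {RV P >-> R} :=
  mfun_Sub (mem_set mX).

(** By the product rule, the joint law of such a pair depends only on the two
    marginal laws. *)
Lemma eq_integral_independent X Z Z' (f : R * R -> \bar R)
    (mX : measurable_fun setT X) (mZ : measurable_fun setT Z)
    (mZ' : measurable_fun setT Z') (mf : measurable_fun setT f) :
  (forall A : set R, measurable A -> P (Z @^-1` A) = P (Z' @^-1` A)) ->
  (forall A B : set R, measurable A -> measurable B ->
     P (X @^-1` A `&` Z @^-1` B) = (P (X @^-1` A) * P (Z @^-1` B))%E) ->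
  (forall A B : set R, measurable A -> measurable B ->
     P (X @^-1` A `&` Z' @^-1` B) = (P (X @^-1` A) * P (Z' @^-1` B))%E) ->
  P.-integrable setT (fun w => f (X w, Z w)) ->
  P.-integrable setT (fun w => f (X w, Z' w)) ->
  (\int[P]_w f (X w, Z w) = \int[P]_w f (X w, Z' w))%E.
Proof.
move=> eqZ iXZ iXZ' intXZ intXZ'.
have mXZ : measurable_fun setT (fun w => (X w, Z w)) by exact: measurable_fun_pair.
have mXZ' : measurable_fun setT (fun w => (X w, Z' w)) by exact: measurable_fun_pair.
pose rX := mk_rv mX; pose rZ := mk_rv mZ.
pose rXZ : {RV P >-> (R * R)%type} := mfun_Sub (mem_set mXZ).
pose rXZ' : {RV P >-> (R * R)%type} := mfun_Sub (mem_set mXZ').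
have e1 := integral_distribution (X := rXZ) mf intXZ.
have e2 := integral_distribution (X := rXZ') mf intXZ'.
transitivity (\int[distribution P rXZ]_z f z)%E; first by rewrite e1.
transitivity (\int[distribution P rXZ']_z f z)%E; last by rewrite e2.
apply: eq_measure_integral => A mA _.
have u1 := @product_measure_unique _ _ _ _ _ (distribution P rX) (distribution P rZ)
  (distribution P rXZ) _ A mA.
have u2 := @product_measure_unique _ _ _ _ _ (distribution P rX) (distribution P rZ)
  (distribution P rXZ') _ A mA.
rewrite -u1; first rewrite -u2//.
- by move=> B C mB mC; rewrite /= /distribution/= /pushforward/= eqZ//; exact: iXZ'.
- by move=> B C mB mC; exact: iXZ.
Qed.

Lemma integrable_mul X Z : measurable_fun setT X -> measurable_fun setT Z ->
  (\int[P]_w (X w ^+ 2)%:E < +oo)%E -> (\int[P]_w (Z w ^+ 2)%:E < +oo)%E ->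
  P.-integrable setT (fun w => (X w * Z w)%:E).
Proof.
move=> mX mZ X2 Z2.
have sq (V : T -> R) : measurable_fun setT V -> (\int[P]_w (V w ^+ 2)%:E < +oo)%E ->
    P.-integrable setT (fun w => (V w ^+ 2)%:E).
  move=> mV V2; apply/integrableP; split.
    by apply/measurable_EFinP; exact: measurable_funX.
  by under eq_integral do rewrite gee0_abs ?lee_fin ?sqr_ge0//.
apply: (le_integrable _ _ _ (integrableD measurableT (sq _ mX X2) (sq _ mZ Z2))) => //.
  by apply/measurable_EFinP; exact: measurable_funM.
move=> w _ /=; rewrite lee_fin [leRHS]ger0_norm ?addr_ge0 ?sqr_ge0//.
rewrite normrM -(real_normK (num_real (X w))) -(real_normK (num_real (Z w))).
have := sqr_ge0 (`|X w| - `|Z w|); have := mulr_ge0 (normr_ge0 (X w)) (normr_ge0 (Z w)).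
by rewrite sqrrB; lra.
Qed.

End independent_symmetric.

Section white_noise_moments.
Context d (Omega : measurableType d) (R : realType) (P : probability Omega R).
Context (Y : hilbertType R) (E : nat -> Y -> Omega -> R).
Hypothesis hE : iid_white_noise P E.

Lemma measurable_noise i y : measurable_fun setT (E i y).
Proof. by have [h _] := hE; exact: white_measurable. Qed.

Lemma noise_variance i y : (\int[P]_w (E i y w ^+ 2)%:E = (`|y| ^+ 2)%:E)%E.
Proof.
have [h _] := hE; rewrite -inner_norm -(white_covariance (h i)) unlock.
by under eq_integral do rewrite expr2.
Qed.

Lemma noise_opp i y : {ae P, forall w, E i (- y) w = - E i y w}.
Proof.
have [h _] := hE.
have E0 : {ae P, forall w, E i 0 w = 0}.
  by have := white_gaussian (h i) 0; rewrite /gaussian_rv normr0 eqxx.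
have := white_linear (h i) (-1) y 0; rewrite scaleN1r addr0.
by apply: filterS2 E0 => w -> ->; rewrite mulN1r addr0.
Qed.

Lemma noise_opp_law i y (A : set R) : y != 0 -> measurable A ->
  P (E i y @^-1` A) = P (E i (- y) @^-1` A).
Proof.
move=> y0 mA; have [h _] := hE.
have := white_gaussian (h i) y; have := white_gaussian (h i) (- y).
by rewrite /gaussian_rv normrN normr_eq0 (negbTE y0) => -> // ->.
Qed.

Lemma noise_independent i j y y' (A B : set R) : i != j ->
  measurable A -> measurable B ->
  P (E i y @^-1` A `&` E j y' @^-1` B)
    = (P (E i y @^-1` A) * P (E j y' @^-1` B))%E.
Proof.
move=> ij mA mB; have [_ h] := hE.
pose C k := if k == i then E i y @^-1` A else E j y' @^-1` B.
have := h [:: i; j] C; rewrite /= inE ij => /(_ isT).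
rewrite !big_cons big_nil mule1 /C eqxx eq_sym (negbTE ij).
have -> : \bigcap_(k in [set` [:: i; j]]) (if k == i then E i y @^-1` A else E j y' @^-1` B)
    = E i y @^-1` A `&` E j y' @^-1` B.
  apply/seteqP; split => w /= h'.
    split; first by have := h' i; rewrite /= inE eqxx; exact.
    by have := h' j; rewrite /= !inE eqxx orbT eq_sym (negbTE ij); exact.
  by move=> k /=; case: ifP => _ _; case: h'.
apply => k; rewrite !inE => /orP[/eqP ->|/eqP ->].
  rewrite eqxx; apply: sub_sigma_algebra; exists y; exists A => //.
  by rewrite setTI.
rewrite eq_sym (negbTE ij); apply: sub_sigma_algebra; exists y'; exists B => //.
by rewrite setTI.
Qed.

Lemma integrable_noise_mul i j y y' :
  P.-integrable setT (fun w => (E i y w * E j y' w)%:E).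
Proof.
by apply: integrable_mul; rewrite ?noise_variance ?ltry//; exact: measurable_noise.
Qed.

(** Replacing [y'] by its opposite does not change the joint law of the pair, but
    it changes the sign of the product. *)
Lemma noise_uncorrelated i j y y' : i != j ->
  (\int[P]_w (E i y w * E j y' w)%:E = 0)%E.
Proof.
move=> ij.
have opp : (\int[P]_w (E i y w * E j (- y') w)%:E
    = - \int[P]_w (E i y w * E j y' w)%:E)%E.
  rewrite -integralN/=; last exact/integrable_add_def/integrable_noise_mul.
  apply: ae_eq_integral => //.
  - by have /integrableP[] := integrable_noise_mul i j y (- y').
  - by have /integrableP[] := integrableN (integrable_noise_mul i j y y').
  apply: filterS (noise_opp j y') => w -> _.
  by rewrite mulrN EFinN.
have fin : (\int[P]_w (E i y w * E j y' w)%:E)%E \is a fin_num.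
  exact/integrable_fin_num/integrable_noise_mul.
have [y0|y0] := eqVneq y' 0.
  move: opp fin; rewrite y0 oppr0; case: (integral _ _ _) => //= r.
  by move=> [rr] _; congr EFin; lra.
have : (\int[P]_w (E i y w * E j y' w)%:E = \int[P]_w (E i y w * E j (- y') w)%:E)%E.
  apply: (@eq_integral_independent _ _ _ P (E i y) (E j y') (E j (- y')) (fun z => (z.1 * z.2)%:E)).
  - exact: measurable_noise.
  - exact: measurable_noise.
  - exact: measurable_noise.
  - by apply/measurable_EFinP; apply: measurable_funM.
  - by move=> A mA; exact: noise_opp_law.
  - by move=> A B mA mB; exact: noise_independent.
  - by move=> A B mA mB; exact: noise_independent.
  - exact: integrable_noise_mul.
  - exact: integrable_noise_mul.
rewrite opp; move: fin; case: (integral _ _ _) => //= r _.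
by move=> [rr]; congr EFin; lra.
Qed.

Lemma noise_sum_variance m (c : 'I_m -> R) y :
  (\int[P]_w ((\sum_(j < m) c j * E j y w) ^+ 2)%:E
    = ((\sum_(j < m) c j ^+ 2) * `|y| ^+ 2)%:E)%E.
Proof.
have sqE w : ((\sum_(j < m) c j * E j y w) ^+ 2)%:E
    = (\sum_(jk : 'I_m * 'I_m) (c jk.1 * c jk.2)%:E * (E jk.1 y w * E jk.2 y w)%:E)%E.
  rewrite expr2 big_distrlr/= pair_bigA/= -sumEFin.
  by apply: eq_bigr => jk _; rewrite -EFinM mulrACA.
under eq_integral do rewrite sqE.
rewrite integral_sum//; last first.
  by move=> jk; apply: integrableZl => //; exact: integrable_noise_mul.
rewrite (eq_bigr (fun jk : 'I_m * 'I_m =>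
    (if jk.1 == jk.2 then c jk.1 ^+ 2 * `|y| ^+ 2 else 0)%:E)); last first.
  move=> [j k] _ /=; rewrite integralZl//; last exact: integrable_noise_mul.
  case: eqVneq => [->|jk].
    under eq_integral do rewrite -expr2.
    by rewrite noise_variance -EFinM expr2.
  by rewrite noise_uncorrelated ?mule0.
rewrite sumEFin -(pair_bigA _ (fun j k : 'I_m => if j == k then c j ^+ 2 * `|y| ^+ 2 else 0))/=.
rewrite mulr_suml; congr EFin; apply: eq_bigr => j _.
rewrite (bigD1 j)//= eqxx big1 ?addr0// => k kj.
by rewrite eq_sym (negbTE kj).
Qed.

End white_noise_moments.

(** * Upper bound: piecewise constant estimators *)

Section piecewise_constant.
Context (R : realType) (X Y : hilbertType R) (mu : probability (borel X) R).
Context (p : R) (p1 : 1 <= p) (hY : separable Y).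
Context (D : set nat) (psi : nat -> Y) (hpsi : orthonormal_basis D psi).
Context (K : finType) (Q : K -> X -> bool) (I : nat).
Hypothesis mQ : forall k, measurable ([set x | Q k x] : set (borel X)).

Notation idx := (K * 'I_I)%type.
Implicit Types v : idx -> R.

(** The value depends on [x] only through the pattern of the sets [Q k] that
    contain it; this makes it measurable even though the sets may overlap. *)
Definition piecewise v (x : X) : Y :=
  if [pick k | Q k x] is Some k then \sum_(i < I | (i : nat) \in D) v (k, i) *: psi i
  else 0.

Definition coef_dist v v' : R := \sum_(ki : idx | (ki.2 : nat) \in D) `|v ki - v' ki|.

Let measurable_pattern (g : {ffun K -> bool} -> Y) :
  measurable_fun setT ((fun x => g [ffun k => Q k x]) : borel X -> borel Y).
Proof.
move=> _ C mC; rewrite setTI.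
rewrite (_ : _ @^-1` _ = \bigcup_(q in [set q | C (g q)])
    \bigcap_(k in [set: K]) [set x | Q k x = q k]); last first.
  apply/seteqP; split => x /=.
    by move=> Cx; exists [ffun k => Q k x] => // k _ /=; rewrite ffunE.
  move=> [q Cq qx]; rewrite (_ : [ffun k => Q k x] = q)//.
  by apply/ffunP => k; rewrite ffunE; exact: qx.
apply: countable_bigcup_measurable => // q _.
apply: fin_bigcap_measurable => // k _; case: (q k); first exact: mQ.
rewrite (_ : [set x | _] = ~` [set x | Q k x]); first exact: measurableC.
by apply/seteqP; split => x /=; [move=> ->|move/negP/negbTE].
Qed.

Lemma measurable_piecewise v :
  measurable_fun setT (piecewise v : borel X -> borel Y).
Proof.
have := measurable_pattern (fun q => if [pick k | q k] is Some k
  then \sum_(i < I | (i : nat) \in D) v (k, i) *: psi i else 0).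
congr (measurable_fun _ _); apply/funext => x; rewrite /piecewise.
by rewrite (@eq_pick _ (fun k => [ffun k => Q k x] k) (Q^~ x))// => k /=; rewrite ffunE.
Qed.

Lemma norm_piecewiseB v v' x : `|piecewise v x - piecewise v' x| <= coef_dist v v'.
Proof.
rewrite /piecewise; case: pickP => [k _|_]; last by rewrite subr0 normr0 sumr_ge0.
rewrite -sumrB (le_trans (ler_norm_sum _ _ _))//.
have -> : coef_dist v v' =
    \sum_(l : K) \sum_(i < I | (i : nat) \in D) `|v (l, i) - v' (l, i)|.
  by rewrite pair_big_dep/=; apply: eq_big => [[l i]|[l i] _].
rewrite (bigD1 k)//= -[leLHS]addr0 lerD//; last first.
  by apply: sumr_ge0 => l _; exact: sumr_ge0.
apply: ler_sum => i Di; rewrite -scalerBl normrZ (norm_basis hpsi) ?mulr1//; exact: set_mem.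
Qed.

Lemma piecewise0 x : piecewise (fun=> 0) x = 0.
Proof.
rewrite /piecewise; case: pickP => // k _.
by apply: big1 => i _; rewrite scale0r.
Qed.

Lemma Lp_space_piecewise v : Lp_space mu p (piecewise v).
Proof.
apply: (bounded_Lp_space mu p1 hY (c := coef_dist v (fun=> 0))).
  exact: measurable_piecewise.
by move=> x; have := norm_piecewiseB v (fun=> 0) x; rewrite piecewise0 subr0.
Qed.

Lemma Lp_dist_piecewise v v' :
  (Lp_dist mu p (piecewise v) (piecewise v') <= (coef_dist v v')%:E)%E.
Proof.
apply: Lp_dist_le => //; try exact: measurable_piecewise.
by move=> x; exact: norm_piecewiseB.
Qed.

(** As the space of coefficients is second countable, the preimage of an open
    set is a countable union of boxes with rational centers and radii. *)
Lemma estimators_piecewise d (Data : measurableType d) (T : Data -> idx -> R) :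
  (forall ki, measurable_fun setT (T ^~ ki)) ->
  estimators Y mu p Data (fun z => piecewise (T z)).
Proof.
move=> mT; split; first by move=> z; exact: Lp_space_piecewise.
move=> U [_ oU].
pose box (qr : {ffun idx -> rat} * rat) v :=
  forall ki, `|v ki - ratr (qr.1 ki)| < ratr qr.2.
rewrite (_ : _ @^-1` U = \bigcup_(qr in [set qr | box qr `<=` piecewise @^-1` U])
    [set z | box qr (T z)]); last first.
  apply/seteqP; split => z; last by move=> [qr /= h /h].
  move=> Uz; have [e e0 he] := oU _ Uz.
  pose e' := e / (4 * #|{: idx}|.+1%:R).
  have e'0 : 0 < e' by rewrite divr_gt0// mulr_gt0.
  have [r] : exists r : rat, ratr r \in `]0, e'[ by exact: rat_in_itvoo.
  rewrite in_itv/= => /andP[r0 re'].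
  have hq ki : exists q : rat, `|T z ki - ratr q| < ratr r.
    have [q] : exists q : rat, ratr q \in `]T z ki - ratr r, T z ki + ratr r[.
      by apply: rat_in_itvoo; rewrite ltrD2l (lt_trans _ r0)// oppr_lt0.
    by rewrite in_itv/= => qT; exists q; rewrite distrC ltr_distl.
  pose q : {ffun idx -> rat} := [ffun ki => projT1 (cid (hq ki))].
  have qT : box (q, r) (T z).
    by move=> ki; rewrite /q /= ffunE; case: cid.
  exists (q, r) => // v qv /=; apply: he; first exact: Lp_space_piecewise.
  rewrite (le_lt_trans (Lp_dist_piecewise _ _))// lte_fin.
  have vT ki : `|v ki - T z ki| <= 2 * e'.
    have := ler_distD (ratr (q ki)) (v ki) (T z ki).
    have := qT ki; have := qv ki; rewrite /= [X in _ -> X < _ -> _]distrC.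
    by lra.
  rewrite (@le_lt_trans _ _ (#|{: idx}|%:R * (2 * e')))//.
    rewrite mulr_natl -sumr_const /coef_dist big_mkcond.
    by apply: ler_sum => ki _; case: ifP => _; rewrite ?vT// mulr_ge0// ltW.
  rewrite [ltLHS](_ : _ = e * (#|{: idx}|%:R / #|{: idx}|.+1%:R) / 2); last first.
    by rewrite /e'; field; rewrite nat1r.
  have : #|{: idx}|%:R / #|{: idx}|.+1%:R <= 1 :> R.
    by rewrite ler_pdivrMr// mul1r ler_nat.
  by move=> h; rewrite ltr_pdivrMr// (@le_lt_trans _ _ e) ?ler_piMr ?(ltW e0)//; lra.
apply: countable_bigcup_measurable => // qr _.
rewrite (_ : [set z | _] = \bigcap_(ki in [set: idx])
    [set z | `|T z ki - ratr (qr.1 ki)| < ratr qr.2]); last first.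
  by apply/seteqP; split => z /= h ki; [move=> _; exact: h|exact: h].
apply: fin_bigcap_measurable => // ki _; rewrite -[X in measurable X]setTI.
have mn : measurable_fun setT (fun z => `|T z ki - ratr (qr.1 ki)|).
  by apply: measurableT_comp => //; exact: measurable_funB.
by rewrite -preimage_itvNyo; exact: mn.
Qed.

End piecewise_constant.

(** The inequality [2 |f| <= eta + f^2 / eta], integrated; the choice of [eta] takes
    the place of the square root in the Cauchy-Schwarz inequality. *)
Lemma L1_le_of_L2 d (T : measurableType d) (R : realType) (P : probability T R)
    (f : T -> R) (V eta : R) : measurable_fun setT f -> 0 < eta ->
  (\int[P]_x (f x ^+ 2)%:E <= V%:E)%E ->
  (\int[P]_x `|f x|%:E <= ((eta + V / eta) / 2)%:E)%E.
Proof.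
move=> mf eta0 fV.
have mf2 : measurable_fun setT (fun x => (f x ^+ 2)%:E).
  by apply/measurable_EFinP; exact: measurable_funX.
apply: (@le_trans _ _ (\int[P]_x ((eta / 2)%:E + ((2 * eta)^-1)%:E * (f x ^+ 2)%:E))%E).
  apply: ge0_le_integral => //.
  - by apply/measurable_EFinP; exact: measurableT_comp.
  - apply: emeasurable_funD => //.
    by apply: measurable_funeM.
  move=> x _; rewrite -EFinM -EFinD lee_fin -(real_normK (num_real (f x))).
  rewrite -subr_ge0 (_ : _ - _ = (eta - `|f x|) ^+ 2 / (2 * eta)); last first.
    by field; rewrite gt_eqF.
  by rewrite divr_ge0 ?sqr_ge0// mulr_ge0// ltW.
have e20 : 0 <= (2 * eta)^-1 by rewrite invr_ge0 mulr_ge0// ltW.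
rewrite ge0_integralD//; last 3 first.
- by move=> x _; rewrite lee_fin divr_ge0// ltW.
- by move=> x _; rewrite -EFinM lee_fin mulr_ge0// sqr_ge0.
- exact: measurable_funeM.
rewrite integral_cst// [X in (_ * X)%E](_ : _ = 1%E); last exact: probability_setT.
rewrite mule1 ge0_integralZl_EFin//; last by move=> x _; rewrite lee_fin sqr_ge0.
apply: (@le_trans _ _ ((eta / 2)%:E + (2 * eta)^-1%:E * V%:E)%E).
  by rewrite leeD2l// lee_wpmul2l// lee_fin.
rewrite -EFinM -EFinD lee_fin le_eqVlt; apply/orP; left; apply/eqP.
by field; rewrite gt_eqF.
Qed.

Section piecewise_risk.
Context (R : realType) (X Y : hilbertType R) (mu : probability (borel X) R).
Context (p : R) (p1 : 1 <= p) (hY : separable Y).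
Context (D : set nat) (psi : nat -> Y) (hpsi : orthonormal_basis D psi).
Context (w : nat -> R) (t B L : R).
Hypotheses (hw : forall i, w i = i.+1%:R).
Hypotheses (t0 : 0 < t) (B0 : 0 < B) (L0 : 0 < L).
Context (K : finType) (Q : K -> X -> bool) (I : nat).
Hypothesis mQ : forall k, measurable ([set x | Q k x] : set (borel X)).
Context (pt : K -> X) (bad : set (borel X)) (rho : R).
Hypotheses (mbad : measurable bad) (rho0 : 0 <= rho).
Hypothesis cover : forall x, ~ bad x -> exists k, Q k x.
Hypothesis close : forall k x, ~ bad x -> Q k x -> `|x - pt k| <= rho.

Notation idx := (K * 'I_I)%type.
Let class := @lipschitz_class R X Y D psi w t B L.
Implicit Types F : X -> Y.

Definition target F (ki : idx) : R := inner (F (pt ki.1)) (psi ki.2).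

Definition approx_error : \bar R :=
  ((L * rho + B * I.+1%:R `^ (- t))%:E + (2 * B)%:E * mu bad `^ p^-1)%E.

Let piecewise_target F x : piecewise D psi Q (target F) x =
  if [pick k | Q k x] is Some k then basis_proj D psi I (F (pt k)) else 0.
Proof.
rewrite /piecewise; case: pickP => // k _.
by rewrite /basis_proj big_mkord.
Qed.

(** Off [bad], the Lipschitz bound over a cell of radius [rho] and the tail of the
    expansion in [psi] add up; on [bad] both functions are at most [B]. *)
Lemma Lp_dist_target F : class F ->
  (Lp_dist mu p F (piecewise D psi Q (target F)) <= approx_error)%E.
Proof.
move=> hF; have FB x : `|F x| <= B by exact: lipschitz_class_bounded hF.
have mF : measurable_fun setT (F : borel X -> borel Y).
  exact: lipschitz_class_measurable hF.
have mG := measurable_piecewise D psi mQ (target F).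
have mFG := measurable_dist hY mF mG.
apply: (Lnorm_le_off mu p1 mFG mbad).
- by rewrite addr_ge0// mulr_ge0 ?powR_ge0// ltW.
- by rewrite mulr_ge0// ltW.
- move=> x xbad; rewrite normr_id piecewise_target; case: pickP => [k kx|no].
    have -> : F x - basis_proj D psi I (F (pt k)) =
        (F x - F (pt k)) + (F (pt k) - basis_proj D psi I (F (pt k))).
      by rewrite addrA subrK.
    rewrite (le_trans (ler_normD _ _))// lerD//.
      have [_ /(_ x (pt k)) h] := hF; rewrite (le_trans h)//.
      by rewrite ler_pM2l//; exact: close.
    by have [+ _] := hF => /(_ (pt k)); exact: weighted_norm_residual.
  by have [k kx] := cover xbad; have := no k; rewrite kx.
move=> x _; rewrite normr_id piecewise_target (le_trans (ler_normB _ _))//.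
rewrite (_ : 2 * B = B + B); last by ring.
rewrite lerD//; case: pickP => [k _|_]; last by rewrite normr0 ltW.
by rewrite (le_trans (norm_basis_proj hpsi _ _)).
Qed.

Context d (Omega : measurableType d) (P : probability Omega R).
Context (E : nat -> Y -> Omega -> R) (sigma : R).
Hypotheses (hE : iid_white_noise P E) (sigma0 : 0 < sigma).

Definition weighted_coef m (c : K -> 'I_m -> R) (o : obs_space Y m) (ki : idx) : R :=
  \sum_(j < m) c ki.1 j * o j (psi ki.2).

Definition weighted_bias m (c : K -> 'I_m -> R) (x : m.-tuple X) F (ki : idx) : R :=
  \sum_(j < m) c ki.1 j * inner (F (tnth x j)) (psi ki.2) - target F ki.

(** The Lp distance of two piecewise functions is at most the sum of the distances
    of their coefficients, so it suffices to bound the bias and the mean absolute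
    noise of each single coefficient. *)
Lemma conditional_risk_le m (c : K -> 'I_m -> R) (V eta : R)
    (x : m.-tuple (borel X)) F :
  0 < eta -> class F -> (forall k, \sum_(j < m) c k j ^+ 2 <= V) ->
  (\int[P]_om Lp_dist mu p F
     (piecewise D psi Q (weighted_coef c (observations E sigma F x om)))
   <= approx_error + (\sum_(ki : idx | (ki.2 : nat) \in D)
        (`|weighted_bias c x F ki| + sigma * ((eta + V / eta) / 2)))%:E)%E.
Proof.
move=> eta0 hF cV.
have mF : measurable_fun setT (F : borel X -> borel Y).
  exact: lipschitz_class_measurable hF.
have mE := measurable_noise hE.
pose noise (ki : idx) om := \sum_(j < m) c ki.1 j * E j (psi ki.2) om.
have mnoise (ki : idx) : measurable_fun setT (noise ki).
  by apply: measurable_sum => j; apply: measurable_funM => //; exact: mE.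
have A0 : (0 <= approx_error)%E.
  apply: adde_ge0; last by rewrite mule_ge0 ?poweR_ge0// lee_fin mulr_ge0// ltW.
  by rewrite lee_fin addr_ge0// mulr_ge0 ?powR_ge0// ltW.
have mcoef om : (coef_dist D (target F)
    (weighted_coef c (observations E sigma F x om)) <=
    \sum_(ki : idx | (ki.2 : nat) \in D)
      (`|weighted_bias c x F ki| + sigma * `|noise ki om|)).
  apply: ler_sum => ki _.
  rewrite (_ : _ - _ = - (weighted_bias c x F ki + sigma * noise ki om)).
    by rewrite normrN (le_trans (ler_normD _ _))// normrM (gtr0_norm sigma0).
  rewrite /weighted_coef /weighted_bias /noise /observations.
  under eq_bigr do rewrite mulrDr.
  rewrite big_split/= mulr_sumr.
  have -> : \sum_(i < m) c ki.1 i * (sigma * E i (psi ki.2) om) =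
     \sum_(i < m) sigma * (c ki.1 i * E i (psi ki.2) om).
    by apply: eq_bigr => j _; rewrite mulrCA.
  by ring.
pose term ki om : \bar R :=
  (`|weighted_bias c x F ki|%:E + sigma%:E * `|noise ki om|%:E)%E.
pose bound om : \bar R := (approx_error +
    \sum_(ki <- [seq ki : idx <- index_enum idx | (ki.2 : nat) \in D]) term ki om)%E.
have noise0 ki om : (0 <= term ki om)%E.
  by rewrite /term -EFinM -EFinD lee_fin addr_ge0// mulr_ge0// ltW.
have mterm ki : measurable_fun setT (term ki).
  apply: emeasurable_funD => //; apply: measurable_funeM.
  by apply/measurable_EFinP; exact: measurableT_comp.
apply: (@le_trans _ _ (\int[P]_om bound om)%E).
  apply: ge0_le_integral => //.
  - by move=> om _; exact: Lp_dist_ge0.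
  - apply: (measurable_Lp_loss p1 hY (Data := obs_space Y m)
      (h := fun o => piecewise D psi Q (weighted_coef c o))) => //.
      apply: estimators_piecewise => // ki.
      apply: measurable_sum => j; apply: measurable_funM => //.
      exact: measurable_obs_coord.
    exact: measurable_fixed_observations.
  - by apply: emeasurable_funD => //; exact: emeasurable_sum.
  move=> om _; apply: le_trans (Lp_dist_triangle (G := piecewise D psi Q (target F)) mu p1 hY mF _ _) _.
  - exact: measurable_piecewise.
  - exact: measurable_piecewise.
  apply: leeD; first exact: Lp_dist_target.
  apply: le_trans (Lp_dist_piecewise mu p1 hY hpsi mQ _ _) _.
  rewrite /bound big_filter; have := mcoef om; rewrite -lee_fin => /le_trans; apply.
  by rewrite -sumEFin.
rewrite ge0_integralD//; last 2 first.
- by move=> om _; apply: sume_ge0.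
- exact: emeasurable_sum.
rewrite integral_cst// [X in (_ * X)%E](_ : _ = 1%E); last exact: probability_setT.
rewrite mule1 leeD2l// ge0_integral_sum// big_filter -sumEFin.
apply: lee_sum => ki Di.
rewrite ge0_integralD//; last 2 first.
- by move=> om _; rewrite -EFinM lee_fin mulr_ge0// ltW.
- apply: measurable_funeM.
  by apply/measurable_EFinP; exact: measurableT_comp.
rewrite integral_cst// [X in (_ * X)%E](_ : _ = 1%E); last exact: probability_setT.
rewrite mule1 EFinD leeD2l// ge0_integralZl_EFin ?(ltW sigma0)//; last first.
  by apply/measurable_EFinP; exact: measurableT_comp.
rewrite EFinM lee_wpmul2l ?lee_fin ?(ltW sigma0)//.
apply: L1_le_of_L2 => //.
rewrite (noise_sum_variance hE) (norm_basis hpsi) ?expr1n ?mulr1 ?lee_fin//; exact: set_mem.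
Qed.

End piecewise_risk.

(** * Upper bound: designs *)

Section uniform_design.
Context d (T : measurableType d) (R : realType) (K : nat) (pt : nat -> T).

Definition uniform_points : set T -> \bar R :=
  mscale (K.+1%:R^-1)%:nng (msum (fun k => \d_(pt k)) K.+1).

HB.instance Definition _ := Measure.on uniform_points.

Let uniform_points_setT : uniform_points [set: T] = 1%E.
Proof.
rewrite /uniform_points /mscale/= /msum.
rewrite (eq_bigr (fun=> 1%E)) => [|k _]; last exact: diracT.
by rewrite sumEFin sumr_const card_ord -EFinM mulVf.
Qed.

HB.instance Definition _ :=
  Measure_isProbability.Build _ _ _ uniform_points uniform_points_setT.

Lemma ge0_integral_uniform_points (f : T -> R) : measurable_fun setT f ->
  (forall x, 0 <= f x) ->
  (\int[uniform_points]_x (f x)%:E = (K.+1%:R^-1 * \sum_(k < K.+1) f (pt k))%:E)%E.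
Proof.
move=> mf f0; have mf' : measurable_fun setT (EFin \o f) by exact/measurable_EFinP.
rewrite ge0_integral_mscale//; last by move=> x _; rewrite lee_fin.
rewrite ge0_integral_measure_sum//; last by move=> x _; rewrite lee_fin.
rewrite EFinM -sumEFin; congr (_ * _)%E; apply: eq_bigr => k _.
by rewrite integral_dirac//= [X in (X * _)%E]diracT mul1e.
Qed.

End uniform_design.

Section iid_second_moment.
Context d (T : measurableType d) (R : realType) (nu : probability T R).
Context (z : T -> R) (v : R).
Hypothesis mz : measurable_fun setT z.
Hypothesis hz : forall c, (\int[nu]_x ((z x + c) ^+ 2)%:E <= (v + c ^+ 2)%:E)%E.

(** The hypothesis on [z] is that it is centered with second moment at most [v], in
    the form that an induction by Tonelli's theorem needs: [c] is the sum over the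
    other draws. *)
Lemma iid_sum_second_moment m :
  (\int[iid_law nu m]_x ((\sum_(j < m) z (tnth x j)) ^+ 2)%:E <= (m%:R * v)%:E)%E.
Proof.
have v0 : 0 <= v.
  rewrite -lee_fin; apply: le_trans (_ : (v + 0 ^+ 2)%:E <= _)%E; last first.
    by rewrite expr0n addr0.
  by apply: le_trans (hz 0); apply: integral_ge0 => x _; rewrite lee_fin sqr_ge0.
have mS n : measurable_fun setT (fun x : n.-tuple T => (\sum_(j < n) z (tnth x j)) ^+ 2).
  apply: measurable_funX; apply: measurable_sum => j.
  exact: (measurableT_comp mz (measurable_tnth j)).
elim: m => [|m IH].
  rewrite mul0r /= integral_dirac//; last by apply/measurable_EFinP; exact: (mS 0%N).
  by rewrite big_ord0 expr0n mule0.
rewrite /= ge0_integral_distribution; last 2 first.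
- by apply/measurable_EFinP; exact: mS.
- by move=> y; rewrite lee_fin sqr_ge0.
have eqS (u : T * m.-tuple T) : (\sum_(j < m.+1) z (tnth (tuple_cons u) j)) ^+ 2
    = (z u.1 + \sum_(j < m) z (tnth u.2 j)) ^+ 2.
  rewrite big_ord_recl; congr (_ ^+ 2); congr (z _ + _).
  by apply: eq_bigr => j _; rewrite /tuple_cons tnthS.
under eq_integral do rewrite /= eqS.
have mf : measurable_fun setT (fun u : T * m.-tuple T =>
    ((z u.1 + \sum_(j < m) z (tnth u.2 j)) ^+ 2)%:E).
  apply/measurable_EFinP; apply: measurable_funX; apply: measurable_funD.
    exact: measurableT_comp.
  apply: measurable_sum => j; apply: (measurableT_comp mz).
  exact: (measurableT_comp (measurable_tnth j)).
rewrite fubini_tonelli1//; last by move=> u; rewrite lee_fin sqr_ge0.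
rewrite fubini_tonelli//; last by move=> u; rewrite lee_fin sqr_ge0.
apply: (@le_trans _ _ (\int[iid_law nu m]_y
    (v%:E + ((\sum_(j < m) z (tnth y j)) ^+ 2)%:E))%E).
  apply: ge0_le_integral => //.
  - by move=> y _; apply: integral_ge0 => x _; rewrite lee_fin sqr_ge0.
  - by apply: (measurable_fun_fubini_tonelli_G _ mf) => u; rewrite lee_fin sqr_ge0.
  - by apply: emeasurable_funD => //; apply/measurable_EFinP; exact: mS.
  by move=> y _ /=; rewrite -EFinD; exact: hz.
rewrite ge0_integralD//; last 2 first.
- by move=> y _; rewrite lee_fin sqr_ge0.
- by apply/measurable_EFinP; exact: mS.
rewrite integral_cst// [X in (_ * X)%E](_ : _ = 1%E); last exact: probability_setT.
by rewrite mule1 -natr1 mulrDl mul1r [in leRHS]addrC EFinD leeD2l.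
Qed.

End iid_second_moment.

Section design_risk.
Context (R : realType) (X Y : hilbertType R) (mu : probability (borel X) R).
Context (p : R) (p1 : 1 <= p) (hY : separable Y).
Context (D : set nat) (psi : nat -> Y) (hpsi : orthonormal_basis D psi).
Context (w : nat -> R) (t B L : R).
Hypotheses (hw : forall i, w i = i.+1%:R).
Hypotheses (t0 : 0 < t) (B0 : 0 < B) (L0 : 0 < L).
Context (K : finType) (Q : K -> X -> bool) (I : nat) (k0 : K).
Hypothesis mQ : forall k, measurable ([set x | Q k x] : set (borel X)).
Context (pt : K -> X) (bad : set (borel X)) (rho : R).
Hypotheses (mbad : measurable bad) (rho0 : 0 <= rho).
Hypothesis cover : forall x, ~ bad x -> exists k, Q k x.
Hypothesis close : forall k x, ~ bad x -> Q k x -> `|x - pt k| <= rho.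
Context d (Omega : measurableType d) (P : probability Omega R).
Context (E : nat -> Y -> Omega -> R) (sigma : R).
Hypotheses (hE : iid_white_noise P E) (sigma0 : 0 < sigma).

Notation idx := (K * 'I_I)%type.
Let class := @lipschitz_class R X Y D psi w t B L.
Let err := approx_error mu p t B L I bad rho.

Let design_point (r : nat) : X := pt (nth k0 (enum K) r).

Let design_point_index k : design_point (index k (enum K)) = pt k.
Proof. by rewrite /design_point nth_index ?mem_enum. Qed.

Let index_lt k : (index k (enum K) < #|K|)%N.
Proof. by rewrite cardE index_mem mem_enum. Qed.

Let cardK_gt0 : (0 < #|K|)%N.
Proof. by apply/card_gt0P; exists k0. Qed.

Let sum_idx_le (f : idx -> R) (s : R) : 0 <= s -> (forall ki, f ki <= s) ->
  \sum_(ki : idx | (ki.2 : nat) \in D) f ki <= (#|K| * I)%:R * s.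
Proof.
move=> s0 fs; rewrite big_mkcond.
apply: (@le_trans _ _ (\sum_(ki : idx) s)).
  by apply: ler_sum => ki _; case: ifP.
by rewrite sumr_const card_prod card_ord mulr_natl.
Qed.

(** The design stays at each point for a block of [m %/ #|K|] observations, and the
    mean over a block has no bias. *)
Lemma fixed_design_risk_le m (eta : R) : (#|K| <= m)%N -> 0 < eta ->
  (fixed_design_risk mu P E sigma p class m <=
   err + ((#|K| * I)%:R * (sigma * ((eta + (2 * #|K|%:R / m%:R) / eta) / 2)))%:E)%E.
Proof.
move=> Km eta0; pose n := (m %/ #|K|)%N.
have n0 : (0 < n)%N by rewrite divn_gt0.
have nR0 : 0 < n%:R :> R by rewrite ltr0n.
have m0 : 0 < m%:R :> R by rewrite ltr0n (leq_trans cardK_gt0).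
have nV : n%:R^-1 <= 2 * #|K|%:R / m%:R :> R.
  rewrite ler_pdivlMr// mulrC ler_pdivrMr// -!natrM ler_nat.
  have := divn_eq m #|K|; rewrite -/n => ->; have := ltn_pmod m cardK_gt0.
  nia.
pose x : m.-tuple (borel X) := [tuple design_point (j %/ n)%N | j < m].
pose c (k : K) (j : 'I_m) : R := ((j %/ n)%N == index k (enum K))%:R / n%:R.
have count k : \sum_(j < m) ((j %/ n)%N == index k (enum K))%:R = n%:R :> R.
  set r := index k _.
  have rm : (r.+1 * n <= m)%N.
    apply: leq_trans (leq_trunc_div m #|K|); rewrite mulnC leq_mul2l.
    by rewrite (index_lt k) orbT.
  rewrite -natr_sum; congr _%:R.
  rewrite -(big_mkord xpredT (fun j => ((j %/ n)%N == r : nat)))/=.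
  rewrite (eq_bigr (fun j => if (r * n <= j)%N && (j < r.+1 * n)%N then 1%N else 0%N)); last first.
    by move=> j _; rewrite eqn_leq -ltnS ltn_divLR// leq_divRL// andbC; case: (_ && _).
  rewrite -big_mkcond -(@big_nat_widen _ _ _ 0 (r.+1 * n)%N m (fun j => r * n <= j)%N (fun=> 1%N))//=.
  rewrite -(@big_nat_widenl _ _ _ (r * n)%N 0 (r.+1 * n)%N xpredT (fun=> 1%N))//=.
  by rewrite sum_nat_const_nat muln1 mulSn addnK.
apply: ge_ereal_inf; exists (ereal_inf [set
    ereal_sup [set \int[P]_om Lp_dist mu p F (h (observations E sigma F x om)) | F in class]%E
    | h in estimators Y mu p (obs_space Y m)]); first by exists x.
apply: ge_ereal_inf; eexists.
  exists (fun o : obs_space Y m => piecewise D psi Q (weighted_coef (I := I) psi c o)) => //.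
  apply: estimators_piecewise => // ki.
  apply: measurable_sum => j; apply: measurable_funM => //.
  exact: measurable_obs_coord.
apply: ge_ereal_sup => _ [F hF <-].
have cV k : \sum_(j < m) c k j ^+ 2 <= 2 * #|K|%:R / m%:R.
  apply: le_trans nV; rewrite /c.
  under eq_bigr do rewrite expr_div_n.
  rewrite -mulr_suml (_ : \sum_(j < m) _ = n%:R).
    by rewrite expr2 invfM mulrA divff ?mul1r// gt_eqF.
  by rewrite -(count k); apply: eq_bigr => j _; case: eqP; rewrite ?expr1n ?expr0n.
have := conditional_risk_le (p := p) mu p1 hY hpsi hw t0 B0 L0 I mQ mbad rho0 cover close hE sigma0 x eta0 hF cV.
move=> /le_trans; apply.
rewrite leeD2l// lee_fin.
apply: sum_idx_le.
  rewrite mulr_ge0 ?(ltW sigma0)// divr_ge0// addr_ge0 ?(ltW eta0)//.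
  by rewrite !(divr_ge0, mulr_ge0)// ltW.
move=> ki; rewrite gerDr normr_le0 subr_eq0; apply/eqP.
rewrite /target -[RHS]mul1r -(@divff _ (n%:R : R)) ?gt_eqF// -{1}(count ki.1).
rewrite !mulr_suml; apply: eq_bigr => j _; rewrite /c tnth_mktuple.
by case: eqP => [->|_]; rewrite ?mul0r// design_point_index.
Qed.

Let sum_design_points (f : X -> R) :
  \sum_(r < #|K|) f (design_point r) = \sum_k f (pt k).
Proof.
rewrite -[RHS]big_enum (big_nth k0)/= -cardE big_mkord.
by apply: eq_bigr.
Qed.

Let hit k (x : borel X) : R := \1_[set pt k] x.

Let measurable_hit k : measurable_fun setT (hit k).
Proof.
apply: measurable_indic; rewrite -[X in measurable X]setCK; apply: measurableC.
apply: borel_open; rewrite openC; apply: accessible_closed_set1.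
exact/hausdorff_accessible/norm_hausdorff.
Qed.

Hypothesis pt_inj : injective pt.

Let hit_pt k l : hit k (pt l) = (l == k)%:R.
Proof.
rewrite /hit indicE; have [->|lk] := eqVneq l k; first by rewrite mem_set.
by rewrite memNset// => /pt_inj/eqP; rewrite (negbTE lk).
Qed.

Let nu : probability (borel X) R := @uniform_points _ (borel X) R #|K|.-1 design_point.

(** The importance weight of a draw at [pt k] is [#|K|], which makes its mean one;
    [centered k s] is a rescaled and centered draw of the observed value [s]. *)
Let centered k (s : R) (x : borel X) : R := s * (#|K|%:R * hit k x - 1).

Let measurable_centered k s : measurable_fun setT (centered k s).
Proof.
apply: measurable_funM => //; apply: measurable_funB => //.
exact: measurable_funM.
Qed.

Let centered_second_moment k (s c : R) : `|s| <= B ->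
  (\int[nu]_x ((centered k s x + c) ^+ 2)%:E <= (B ^+ 2 * #|K|%:R + c ^+ 2)%:E)%E.
Proof.
move=> sB; rewrite ge0_integral_uniform_points; last 2 first.
- by apply: measurable_funX; apply: measurable_funD.
- by move=> x; exact: sqr_ge0.
rewrite lee_fin prednK// (sum_design_points (fun x => (centered k s x + c) ^+ 2)).
have K0 : #|K|%:R != 0 :> R by rewrite pnatr_eq0 -lt0n.
have K1 : 1 <= #|K|%:R :> R by rewrite ler1n.
rewrite mulrC ler_pdivrMr ?ltr0n// (bigD1 k)//= (eq_bigr (fun=> (c - s) ^+ 2)); last first.
  by move=> l lk; rewrite /centered hit_pt (negbTE lk) mulr0 sub0r mulrN1 addrC.
rewrite sumr_const -[X in _ + X]mulr_natl /centered hit_pt eqxx mulr1.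
have -> : #|(fun i => i != k) : pred K|%:R = #|K|%:R - 1 :> R.
  have := cardC1 k; rewrite (eq_card (B := predC1 k))// => ->.
  by rewrite -subn1 natrB.
have s2 : s ^+ 2 <= B ^+ 2 by rewrite -(real_normK (num_real s)) ler_pXn2r ?nnegrE// ltW.
rewrite [leLHS](_ : _ = (s ^+ 2 * (#|K|%:R - 1) + c ^+ 2) * #|K|%:R); last by ring.
rewrite ler_wpM2r// lerD2r ler_pM ?sqr_ge0 ?subr_ge0//; lra.
Qed.

(** For uniformly drawn design points, weighting the observations made at [pt k] by
    [#|K| / m] leaves no bias on average, and a second moment of order [#|K| / m]. *)
Lemma random_design_risk_le m (eta : R) : (0 < m)%N -> 0 < eta ->
  (random_design_risk mu P E sigma p class m <=
   err + ((#|K| * I)%:R * ((eta + (B ^+ 2 * #|K|%:R / m%:R) / eta) / 2 +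
      sigma * ((eta + (#|K|%:R ^+ 2 / m%:R) / eta) / 2)))%:E)%E.
Proof.
move=> m_gt0 eta0.
have m0 : 0 < m%:R :> R by rewrite ltr0n.
pose c (x : m.-tuple (borel X)) (k : K) (j : 'I_m) : R :=
  #|K|%:R / m%:R * hit k (tnth x j).
have mhit k (j : 'I_m) : measurable_fun setT (fun x : m.-tuple (borel X) => hit k (tnth x j)).
  exact: (measurableT_comp (measurable_hit k) (measurable_tnth j)).
pose h (z : m.-tuple (borel X) * obs_space Y m) :=
  piecewise D psi Q (weighted_coef (I := I) psi (c z.1) z.2).
have hh : estimators Y mu p (m.-tuple (borel X) * obs_space Y m)%type h.
  apply: estimators_piecewise => // ki.
  apply: measurable_sum => j; apply: measurable_funM.
    apply: measurable_funM => //.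
    exact: (measurableT_comp (mhit ki.1 j)).
  exact: (measurableT_comp (measurable_obs_coord j (psi ki.2))).
apply: ge_ereal_inf; exists (ereal_inf [set
    ereal_sup [set \int[iid_law nu m \x P]_z
      Lp_dist mu p F (h (z.1, observations E sigma F z.1 z.2)) | F in class]%E
    | h in estimators Y mu p (m.-tuple (borel X) * obs_space Y m)%type]); first by exists nu.
apply: ge_ereal_inf; eexists; first by exists h.
apply: ge_ereal_sup => _ [F hF <-].
have FB x : `|F x| <= B by exact: lipschitz_class_bounded hF.
have mF : measurable_fun setT (F : borel X -> borel Y).
  exact: lipschitz_class_measurable hF.
have mE := measurable_noise hE.
have mloss : measurable_fun setT (fun z : m.-tuple (borel X) * Omega =>
    Lp_dist mu p F (h (z.1, observations E sigma F z.1 z.2))).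
  apply: (measurable_Lp_loss p1 hY (o := fun z => (z.1, observations E sigma F z.1 z.2)) hh) => //.
  apply: measurable_fun_pair => //.
  by apply: measurable_observations => //; exact: lipschitz_class_continuous hF.
have cV x k : \sum_(j < m) c x k j ^+ 2 <= #|K|%:R ^+ 2 / m%:R.
  apply: (@le_trans _ _ (\sum_(j < m) (#|K|%:R / m%:R) ^+ 2)).
    apply: ler_sum => j _; rewrite /c exprMn ler_piMr ?sqr_ge0// /hit indicE.
    by case: (_ \in _); rewrite ?expr1n ?expr0n.
  rewrite sumr_const card_ord -mulr_natr exprMn exprVn expr2 -mulrA.
  rewrite le_eqVlt; apply/orP; left; apply/eqP; field.
  by rewrite gt_eqF.
pose s := sigma * ((eta + (#|K|%:R ^+ 2 / m%:R) / eta) / 2).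
have s0 : 0 <= s.
  rewrite mulr_ge0 ?(ltW sigma0)// divr_ge0// addr_ge0 ?(ltW eta0)//.
  by rewrite !divr_ge0// ?exprn_ge0// ltW.
pose bias (ki : idx) x : R := weighted_bias psi pt (c x) x F ki.
pose val (ki : idx) : R := target psi pt F ki.
have valB (ki : idx) : (ki.2 : nat) \in D -> `|val ki| <= B.
  rewrite inE => Di.
  by rewrite (le_trans (cauchy_schwarz _ _))// (norm_basis hpsi)// mulr1.
have biasE (ki : idx) x : bias ki x =
    m%:R^-1 * \sum_(j < m) centered ki.1 (val ki) (tnth x j).
  have -> : bias ki x = \sum_(j < m) (c x ki.1 j * val ki) - val ki.
    rewrite /bias /weighted_bias; congr (_ - _); apply: eq_bigr => j _.
    rewrite /c /hit indicE; have [->//|xj] := pselect (tnth x j = pt ki.1).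
    by rewrite memNset// mulr0 !mul0r.
  rewrite /centered mulr_sumr.
  rewrite [in RHS](eq_bigr (fun j => c x ki.1 j * val ki - m%:R^-1 * val ki)); last first.
    by move=> j _; rewrite /c; ring.
  rewrite sumrB sumr_const card_ord -[X in _ = _ - X]mulr_natl mulrA mulfV ?mul1r//.
  by rewrite gt_eqF.
have mbias (ki : idx) : measurable_fun setT (bias ki).
  rewrite (_ : bias ki = fun x => m%:R^-1 * \sum_(j < m) centered ki.1 (val ki) (tnth x j)).
    apply: measurable_funM => //; apply: measurable_sum => j.
    exact: (measurableT_comp (measurable_centered _ _) (measurable_tnth j)).
  by apply/funext => x; exact: biasE.
have bias2 (ki : idx) : (ki.2 : nat) \in D ->
    (\int[iid_law nu m]_x (bias ki x ^+ 2)%:E <= (B ^+ 2 * #|K|%:R / m%:R)%:E)%E.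
  move=> Di; under eq_integral do rewrite biasE exprMn EFinM.
  have mS : measurable_fun setT (fun x : m.-tuple (borel X) =>
      \sum_(j < m) centered ki.1 (val ki) (tnth x j)).
    apply: measurable_sum => j.
    exact: (measurableT_comp (measurable_centered _ _) (measurable_tnth j)).
  rewrite ge0_integralZl_EFin ?sqr_ge0//; last 2 first.
  - by move=> x _; rewrite lee_fin sqr_ge0.
  - by apply/measurable_EFinP; exact: measurable_funX.
  have := iid_sum_second_moment (measurable_centered ki.1 (val ki))
    (fun c' => centered_second_moment ki.1 c' (valB ki Di)) m.
  move=> /(lee_wpmul2l (_ : (0 <= ((m%:R^-1 : R) ^+ 2)%:E)%E)) => /(_ _)/le_trans; apply.
    by rewrite lee_fin sqr_ge0.
  rewrite -EFinM lee_fin le_eqVlt; apply/orP; left; apply/eqP; field.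
  by rewrite gt_eqF.
rewrite fubini_tonelli1//; last by move=> z; exact: Lp_dist_ge0.
have err0 : (0 <= err)%E.
  apply: adde_ge0; last by rewrite mule_ge0 ?poweR_ge0// lee_fin mulr_ge0// ltW.
  by rewrite lee_fin addr_ge0// mulr_ge0 ?powR_ge0// ltW.
pose term (ki : idx) x : \bar R := (`|bias ki x| + s)%:E.
have term0 ki x : (0 <= term ki x)%E by rewrite lee_fin addr_ge0.
have mterm ki : measurable_fun setT (term ki).
  by apply/measurable_EFinP; apply: measurable_funD => //; exact: measurableT_comp.
pose bound x : \bar R := (err +
    \sum_(ki <- [seq ki : idx <- index_enum idx | (ki.2 : nat) \in D]) term ki x)%E.
apply: (@le_trans _ _ (\int[iid_law nu m]_x bound x)%E).
  apply: ge0_le_integral => //.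
  - by move=> x _; apply: integral_ge0 => om _; exact: Lp_dist_ge0.
  - by apply: (measurable_fun_fubini_tonelli_F _ mloss) => z; exact: Lp_dist_ge0.
  - by apply: emeasurable_funD => //; exact: emeasurable_sum.
  move=> x _; have := conditional_risk_le (p := p) mu p1 hY hpsi hw t0 B0 L0 I
    mQ mbad rho0 cover close hE sigma0 x eta0 hF (cV x).
  by move=> /le_trans; apply; rewrite /bound big_filter -sumEFin.
rewrite ge0_integralD//; last 2 first.
- by move=> x _; apply: sume_ge0.
- exact: emeasurable_sum.
rewrite integral_cst// [X in (_ * X)%E](_ : _ = 1%E); last exact: probability_setT.
rewrite mule1 leeD2l// ge0_integral_sum// big_filter.
have V0 : 0 <= (eta + (B ^+ 2 * #|K|%:R / m%:R) / eta) / 2.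
  rewrite divr_ge0// addr_ge0 ?(ltW eta0)//.
  by rewrite !(divr_ge0, mulr_ge0)// ?sqr_ge0// ltW.
apply: (@le_trans _ _ (\sum_(ki : idx | (ki.2 : nat) \in D)
    ((eta + (B ^+ 2 * #|K|%:R / m%:R) / eta) / 2 + s)%:E)%E); last first.
  by rewrite sumEFin lee_fin sum_idx_le// addr_ge0.
apply: lee_sum => ki Di; rewrite /term.
under eq_integral do rewrite EFinD.
rewrite ge0_integralD//; last first.
  by apply/measurable_EFinP; exact: measurableT_comp.
rewrite integral_cst// [X in (_ + _ * X)%E](_ : _ = 1%E); last exact: probability_setT.
by rewrite mule1 EFinD leeD2r// L1_le_of_L2// bias2.
Qed.

End design_risk.

(** * Upper bound: the grid and the mass outside of it *)

Lemma chebyshev_sq d (T : measurableType d) (R : realType) (P : probability T R)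
    (f : T -> R) (c V : R) : measurable_fun setT f -> 0 < c ->
  (\int[P]_x (f x ^+ 2)%:E <= V%:E)%E ->
  (P [set x | (c < `|f x|)%R] <= (V / c ^+ 2)%:E)%E.
Proof.
move=> mf c0 fV; set A := [set x | _].
have mA : measurable A.
  rewrite -[X in measurable X]setTI /A -preimage_itvoy.
  by apply: (measurableT_comp _ mf) => //; exact: normr_measurable.
have c20 : 0 < c ^+ 2 by rewrite exprn_gt0.
rewrite -(@lee_pmul2l _ (c ^+ 2)%:E)//.
rewrite -EFinM mulrC divfK ?gt_eqF// (le_trans _ fV)//.
rewrite -[X in P X]setIT -integral_indic// -ge0_integralZl_EFin//; last 2 first.
- exact/measurable_EFinP/measurable_indic.
- exact: ltW.
apply: ge0_le_integral => //.
- by move=> x _; rewrite -EFinM lee_fin mulr_ge0// ltW.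
- by apply/measurable_EFinP; apply: measurable_funM => //; exact: measurable_indic.
- by apply/measurable_EFinP; exact: measurable_funX.
move=> x _; rewrite -EFinM lee_fin indicE; have [xA|xA] := pselect (A x).
  rewrite mem_set// mulr1 -(real_normK (num_real (f x))) ler_pXn2r ?nnegrE ?(ltW c0)//.
  exact: ltW.
by rewrite memNset// mulr0 sqr_ge0.
Qed.

Lemma sum_geometric_le (R : realType) (q : R) n : 0 <= q < 1 ->
  \sum_(i < n) q ^+ i <= (1 - q)^-1.
Proof.
move=> /andP[q0 q1]; have q1' : 0 < 1 - q by rewrite subr_gt0.
rewrite -[leRHS]mul1r ler_pdivlMr// mulrC.
have -> : (1 - q) * (\sum_(i < n) q ^+ i) = 1 - q ^+ n.
  elim: n => [|n IH]; first by rewrite big_ord0 mulr0 expr0 subrr.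
  by rewrite big_ord_recr/= mulrDr IH exprS; ring.
by rewrite gerBl exprn_ge0.
Qed.

Section grid_cover.
Context (R : realType) (X : hilbertType R) (mu : probability (borel X) R).
Context (phi : nat -> X) (hphi : orthonormal_basis setT phi).
Context (d N : nat) (r delta : R).
Hypotheses (r0 : 0 < r) (delta0 : 0 < delta).

Local Notation node := (node r N).
Local Notation hw := (half_width r N).

Definition near_cell (k : cell d N) (x : X) : bool :=
  [forall i : 'I_d.+1, `|inner x (phi i) - node (k i)| <= hw].

Definition cell_center (k : cell d N) : X := \sum_(i < d.+1) node (k i) *: phi i.

Definition off_grid : set (borel X) :=
  [set x : borel X | delta < `| `|x - basis_proj setT phi d.+1 x| |]
    `|` [set x : borel X | r < `| `|x : X| |].

Let hw0 : 0 < hw. Proof. by rewrite divr_gt0. Qed.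

Let nodeE j : node j = (2 * j%:R + 1) * hw - r.
Proof. by rewrite /node /half_width; ring. Qed.

Let rE : r = N.+1%:R * hw.
Proof. by rewrite /half_width mulrC divfK. Qed.

Lemma node_near y : `|y| <= r -> exists j : 'I_N.+1, `|y - node j| <= hw.
Proof.
move=> yr; pose s := (y + r) / (2 * hw).
have yE : y = 2 * s * hw - r.
  by rewrite /s; field; rewrite gt_eqF.
move: yr; rewrite ler_norml => /andP[ry yr].
have s0 : 0 <= s by rewrite divr_ge0 ?mulr_ge0 ?(ltW hw0)//; lra.
have sN : s <= N.+1%:R.
  by rewrite ler_pdivrMr ?mulr_gt0// mulrCA -rE; lra.
have near j : j%:R <= s <= j%:R + 1 -> `|y - node j| <= hw.
  move=> /andP[h1 h2]; rewrite nodeE yE.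
  rewrite (_ : _ - _ = (2 * (s - j%:R) - 1) * hw); last by ring.
  by rewrite normrM (gtr0_norm hw0) ler_piMl ?(ltW hw0)// ler_norml; lra.
have [sN'|Ns] := ltP s N.+1%:R.
  have jN : (Num.truncn s < N.+1)%N by rewrite truncn_lt_nat.
  exists (Ordinal jN); apply: near; rewrite truncn_le s0/=.
  by rewrite natr1 ltW// truncnS_gt.
exists ord_max; apply: near => /=.
by have := @natr1 R N; lra.
Qed.

Lemma near_cell_cover x : ~ off_grid x -> exists k, near_cell k x.
Proof.
move=> /not_orP[_ /negP]; rewrite -leNgt normr_id => xr.
have h (i : 'I_d.+1) : exists j : 'I_N.+1, `|inner x (phi i) - node j| <= hw.
  apply: node_near; rewrite (le_trans _ xr)//.
  by rewrite (le_trans (cauchy_schwarz _ _))// (norm_basis hphi)// mulr1.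
exists [ffun i => projT1 (cid (h i))]; apply/forallP => i; rewrite ffunE.
by case: cid.
Qed.

Lemma near_cell_close k x : ~ off_grid x -> near_cell k x ->
  `|x - cell_center k| <= delta + d.+1%:R * hw.
Proof.
move=> /not_orP[/negP + _]; rewrite -leNgt normr_id => xd /forallP kx.
have -> : x - cell_center k = (x - basis_proj setT phi d.+1 x)
    + \sum_(i < d.+1) (inner x (phi i) - node (k i)) *: phi i.
  under eq_bigr do rewrite scalerBl.
  rewrite sumrB addrA; congr (_ - _).
  by rewrite basis_proj_setT subrK.
rewrite (le_trans (ler_normD _ _))// lerD//.
rewrite (le_trans (ler_norm_sum _ _ _))// mulr_natl.
rewrite -[X in _ <= _ *+ X]card_ord -sumr_const; apply: ler_sum => i _.
by rewrite normrZ (norm_basis hphi)// mulr1.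
Qed.

Lemma cell_center_inj : injective cell_center.
Proof.
have coord k (i : 'I_d.+1) : inner (cell_center k) (phi i) = node (k i).
  have [ho _] := hphi.
  rewrite inner_suml (bigD1 i)//= innerZl ho// eqxx mulr1 big1 ?addr0// => j ji.
  by rewrite innerZl ho// (_ : _ == _ = false) ?mulr0//; exact: negbTE.
move=> k l kl; apply/ffunP => i; apply/val_inj => /=.
have := coord k i; rewrite kl coord !nodeE => e.
have : 2 * hw * ((k i)%:R - (l i)%:R) = 0 by lra.
by move=> /eqP; rewrite mulf_eq0 gt_eqF ?mulr_gt0//= subr_eq0 eqr_nat => /eqP.
Qed.

Let measurable_coord i : measurable_fun setT (fun x : borel X => inner (x : X) (phi i)).
Proof. by apply: continuous_borel_realfun; exact: continuous_inner. Qed.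

Lemma measurable_near_cell k : measurable ([set x | near_cell k x] : set (borel X)).
Proof.
rewrite (_ : [set x | _] = \bigcap_(i in [set: 'I_d.+1])
    [set x : borel X | `|inner (x : X) (phi i) - node (k i)| <= hw]); last first.
  apply/seteqP; split => x /=; first by move=> /forallP h i _; exact: h.
  by move=> h; apply/forallP => i; exact: h.
apply: fin_bigcap_measurable => // i _.
rewrite -[X in measurable X]setTI -preimage_itvNyc.
have mn : measurable_fun setT (fun x : borel X => `|inner (x : X) (phi i) - node (k i)|).
  by apply: measurableT_comp => //; exact: measurable_funB.
exact: mn.
Qed.

Lemma continuous_basis_proj n : continuous (basis_proj setT phi n : X -> X).
Proof.
have -> : basis_proj setT phi n = fun x => \sum_(i < n) inner x (phi i) *: phi i.
  by apply/funext => x; rewrite basis_proj_setT.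
elim: n => [|n IH].
  by under eq_fun do rewrite big_ord0; exact: cst_continuous.
under eq_fun do rewrite big_ord_recr/=.
move=> x; apply: cvgD; first exact: IH.
by apply: cvgZ; [exact: (@continuous_inner R X (phi n))|exact: cvg_cst].
Qed.

Lemma continuous_residual : continuous (fun x : X => `|x - basis_proj setT phi d.+1 x| : R).
Proof.
move=> x; apply: cvg_norm; apply: cvgB; first exact: cvg_id.
exact: continuous_basis_proj.
Qed.

Let measurable_residual : measurable_fun setT
  (fun x : borel X => `|(x : X) - basis_proj setT phi d.+1 x|).
Proof. exact: continuous_borel_realfun continuous_residual. Qed.

Let measurable_norm : measurable_fun setT (fun x : borel X => `|x : X|).
Proof. by apply: continuous_borel_realfun; exact: norm_continuous. Qed.

Lemma measurable_off_grid : measurable off_grid.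
Proof.
apply: measurableU; rewrite -[X in measurable X]setTI -preimage_itvoy.
  by apply: (measurableT_comp _ measurable_residual) => //; exact: normr_measurable.
by apply: (measurableT_comp _ measurable_norm) => //; exact: normr_measurable.
Qed.

Lemma mu_off_grid_le (V M : R) :
  (\int[mu]_x (`|(x : X) - basis_proj setT phi d.+1 x| ^+ 2)%:E <= V%:E)%E ->
  (\int[mu]_x (`|x : X| ^+ 2)%:E <= M%:E)%E ->
  (mu off_grid <= (V / delta ^+ 2 + M / r ^+ 2)%:E)%E.
Proof.
move=> hV hM; apply: le_trans (measureU2 _ _ _) _.
- rewrite -[X in measurable X]setTI -preimage_itvoy.
  by apply: (measurableT_comp _ measurable_residual) => //; exact: normr_measurable.
- rewrite -[X in measurable X]setTI -preimage_itvoy.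
  by apply: (measurableT_comp _ measurable_norm) => //; exact: normr_measurable.
by rewrite EFinD leeD//; exact: chebyshev_sq.
Qed.

End grid_cover.

Section karhunen_loeve_tail.
Context (R : realType) (X : hilbertType R) (mu : probability (borel X) R).
Context (C : X -> X) (lambda : nat -> R) (phi : nat -> X) (tau omega : R).
Hypotheses (hC : covariance_operator mu C) (hphi : spectral_basis C lambda phi).
Hypothesis hlambda : forall i, lambda i = expR (- tau * (i.+1%:R `^ omega)).
Hypotheses (tau0 : 0 < tau) (omega1 : 1 <= omega).

Let basis : orthonormal_basis setT phi. Proof. by case: hphi. Qed.

Lemma coord_second_moment i :
  (\int[mu]_x (inner (x : X) (phi i) ^+ 2)%:E = (lambda i)%:E)%E.
Proof.
have [_ _ [ho _] hl] := hphi.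
have := hC (phi i) (phi i); rewrite hl innerZl ho// eqxx mulr1 unlock => <-.
by under eq_integral do rewrite expr2.
Qed.

(** Half of the exponent gives the decay in [n], the other half makes the series
    converge. *)
Lemma eigenvalue_le n i : (n <= i)%N ->
  lambda i <= expR (- (tau / 2 * n%:R `^ omega)) * expR (- (tau / 2)) ^+ i.
Proof.
move=> ni; rewrite hlambda -expRM_natl -expRD ler_expR.
have omega0 : 0 < omega by exact: lt_le_trans omega1.
have h1 : n%:R `^ omega <= i.+1%:R `^ omega :> R.
  by rewrite ge0_ler_powR ?nnegrE ?(ltW omega0)// ler_nat leqW.
have h2 : i%:R <= i.+1%:R `^ omega :> R.
  rewrite (@le_trans _ _ i.+1%:R)// ?ler_nat//.
  by rewrite -[leLHS]powRr1// ler_powR// ler1n.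
rewrite -mulNr -mulrN mulrC; set s := i.+1%:R `^ omega in h1 h2 *.
have h3 : tau / 2 * n%:R `^ omega <= tau / 2 * s by rewrite ler_pM2l ?divr_gt0.
have h4 : tau / 2 * i%:R <= tau / 2 * s by rewrite ler_pM2l ?divr_gt0.
by lra.
Qed.

Definition tail_constant : R := (1 - expR (- (tau / 2)))^-1.

Lemma residual_second_moment n :
  (\int[mu]_x (`|(x : X) - basis_proj setT phi n x| ^+ 2)%:E <=
   (expR (- (tau / 2 * n%:R `^ omega)) * tail_constant)%:E)%E.
Proof.
pose f i (x : borel X) : \bar R :=
  if (n <= i)%N then (inner (x : X) (phi i) ^+ 2)%:E else 0%E.
have mf i : measurable_fun setT (f i).
  rewrite /f; case: (n <= i)%N => //; apply/measurable_EFinP; apply: measurable_funX.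
  by apply: continuous_borel_realfun; exact: continuous_inner.
have f0 i x : (0 <= f i x)%E by rewrite /f; case: ifP; rewrite ?lee_fin ?sqr_ge0.
apply: (@le_trans _ _ (\int[mu]_x \sum_(i <oo) f i x)%E).
  apply: ge0_le_integral => //.
  - apply/measurable_EFinP; apply: measurable_funX.
    apply: continuous_borel_realfun => x; apply: cvg_norm; apply: cvgB.
      exact: cvg_id.
    exact: continuous_basis_proj.
  - by apply: ge0_emeasurable_sum.
  move=> x _; apply: le_trans (sqr_norm_residual_le_series basis n x) _.
  rewrite eseries_cond [leLHS]eseries_mkcond le_eqVlt; apply/orP; left; apply/eqP.
  by apply: eq_eseriesr => i _; rewrite in_setT.
rewrite integral_nneseries//.
have S0 i : (0 <= \int[mu]_x f i x)%E by apply: integral_ge0.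
apply: lime_le; first by apply: is_cvg_nneseries.
near=> k.
apply: (@le_trans _ _ (\sum_(0 <= i < k)
    (expR (- (tau / 2 * n%:R `^ omega)) * expR (- (tau / 2)) ^+ i)%:E)%E).
  apply: lee_sum => i _; rewrite /f; case: (leqP n i) => ni.
    by rewrite coord_second_moment lee_fin eigenvalue_le.
  by rewrite integral0 lee_fin mulr_ge0 ?exprn_ge0 ?expR_ge0.
rewrite sumEFin lee_fin -mulr_sumr ler_pM2l ?expR_gt0// big_mkord.
apply: sum_geometric_le; rewrite expR_ge0/= expR_lt1.
by rewrite oppr_lt0 divr_gt0.
Unshelve. all: by end_near. Qed.

End karhunen_loeve_tail.

(** * Choice of the parameters *)

Section exponential_numbers.
Context (R : realType).

Lemma truncn_expR_bounds (v : R) : 0 <= v ->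
  expR v <= (Num.truncn (expR v)).+1%:R <= 2 * expR v.
Proof.
move=> v0; rewrite ltW ?truncnS_gt//= -natr1.
have h1 : 1 <= expR v by rewrite -expR0 ler_expR.
have : (Num.truncn (expR v))%:R <= expR v by rewrite truncn_le expR_ge0.
by lra.
Qed.

Lemma dim_le_speed (omega : R) n : 1 <= omega -> (1 <= n)%N ->
  1 <= n%:R `^ omega :> R /\ n%:R <= n%:R `^ omega :> R.
Proof.
move=> o1 n1; have h : n%:R <= n%:R `^ omega :> R.
  by rewrite -[leLHS]powRr1// ler_powR// ler1n.
by split => //; rewrite (le_trans _ h)// ler1n.
Qed.

Lemma linear_mul_expRN_le (u : R) : 0 <= u -> u * expR (- u) <= 2 * expR (- (u / 2)).
Proof.
move=> u0; have -> : - u = - (u / 2) + - (u / 2) by lra.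
rewrite expRD mulrA ler_pM2r ?expR_gt0// expRN ler_pdivrMr ?expR_gt0//.
have := expR_ge1Dx (u / 2); lra.
Qed.

End exponential_numbers.

Section upper_bound.
Context (R : realType) (X Y : hilbertType R) (mu : probability (borel X) R).
Context (p : R) (p1 : 1 <= p) (hY : separable Y).
Context (D : set nat) (psi : nat -> Y) (hpsi : orthonormal_basis D psi).
Context (w : nat -> R) (t B L : R).
Hypotheses (hw : forall i, w i = i.+1%:R).
Hypotheses (t0 : 0 < t) (B0 : 0 < B) (L0 : 0 < L).
Context (C : X -> X) (lambda : nat -> R) (phi : nat -> X) (tau omega : R).
Hypotheses (hC : covariance_operator mu C) (hphi : spectral_basis C lambda phi).
Hypothesis hlambda : forall i, lambda i = expR (- tau * (i.+1%:R `^ omega)).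
Hypotheses (tau0 : 0 < tau) (omega1 : 1 <= omega).
Hypothesis mu_moment : finite_second_moment mu.
Context d (Omega : measurableType d) (P : probability Omega R).
Context (E : nat -> Y -> Omega -> R) (sigma : R).
Hypotheses (hE : iid_white_noise P E) (sigma0 : 0 < sigma).

Let class := @lipschitz_class R X Y D psi w t B L.

Let basis : orthonormal_basis setT phi. Proof. by case: hphi. Qed.

Definition second_moment : R := fine (\int[mu]_x (`|x : X| ^+ 2)%:E).

(** Rates at which the radius of the cells, and then the approximation error,
    decrease. *)
Definition cell_rate : R := Num.min (tau / 8) (1 / 2).
Definition upper_rate : R := Num.min t (cell_rate / p).

Definition upper_constant : R :=
  3 * L + B + 2 * B * (tail_constant tau + second_moment) `^ p^-1 +
  2 * (1 + B ^+ 2 + sigma).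

Let second_momentE : (\int[mu]_x (`|x : X| ^+ 2)%:E)%E = second_moment%:E.
Proof.
rewrite /second_moment fineK// ge0_fin_numE//.
by apply: integral_ge0 => x _; rewrite lee_fin sqr_ge0.
Qed.

Let second_moment_ge0 : 0 <= second_moment.
Proof. by apply: fine_ge0; apply: integral_ge0 => x _; rewrite lee_fin sqr_ge0. Qed.

Let tail_constant_ge0 : 0 <= tail_constant tau.
Proof. by rewrite invr_ge0 subr_ge0 expR_le1 oppr_le0 divr_ge0// ltW. Qed.

Lemma cell_rate_gt0 : 0 < cell_rate.
Proof. by rewrite lt_min !divr_gt0. Qed.

Lemma upper_rate_gt0 : 0 < upper_rate.
Proof. by rewrite lt_min t0 divr_gt0 ?cell_rate_gt0// (lt_le_trans _ p1). Qed.

Let p0 : 0 < p. Proof. exact: lt_le_trans p1. Qed.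

Let upper_rate_le : upper_rate <= cell_rate.
Proof.
rewrite (@le_trans _ _ (cell_rate / p))// ?ge_min ?lexx ?orbT//.
by rewrite ler_pdivrMr// ler_peMr// ltW// cell_rate_gt0.
Qed.

Section dimension.
Variable n : nat.
(* With u the power of the dimension, the ball has radius exp u and is cut into
   cells of side at most 2 exp (- u), hence about exp (2 u) along each axis; the
   threshold for the tail is the fourth root of the bound on its second moment. *)
Let u : R := n.+1%:R `^ omega.
Let r : R := expR u.
Let N : nat := Num.truncn (expR (2 * u)).
Let I : nat := Num.truncn (expR u).
Let delta : R := expR (- (tau / 8 * u)).
Let cell_half : R := half_width r N.
Let rho : R := delta + n.+1%:R * cell_half.
Let K := cell n N.

Let u1 : 1 <= u. Proof. by have [] := @dim_le_speed R omega n.+1 omega1 isT. Qed.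
Let dim_le_u : n.+1%:R <= u. Proof. by have [] := @dim_le_speed R omega n.+1 omega1 isT. Qed.
Let u0 : 0 <= u. Proof. exact: le_trans u1. Qed.

Let cell_half_le : cell_half <= expR (- u).
Proof.
have /andP[h _] := truncn_expR_bounds (mulr_ge0 (ler0n R 2) u0).
rewrite /cell_half /half_width /r ler_pdivrMr//.
rewrite (_ : expR u = expR (- u) * expR (2 * u)); last by rewrite -expRD; congr expR; lra.
by rewrite ler_pM2l ?expR_gt0.
Qed.

Let decay (s : R) : cell_rate <= s -> expR (- (s * u)) <= expR (- (cell_rate * u)).
Proof. by move=> h; rewrite ler_expR lerN2 ler_wpM2r. Qed.

Let rho_le : rho <= 3 * expR (- (cell_rate * u)).
Proof.
have h1 : delta <= expR (- (cell_rate * u)) by apply: decay; rewrite ge_min lexx.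
have h2 : n.+1%:R * cell_half <= 2 * expR (- (cell_rate * u)).
  rewrite (@le_trans _ _ (u * expR (- u)))//.
    by rewrite ler_pM// /cell_half /half_width divr_ge0// expR_ge0.
  rewrite (le_trans (linear_mul_expRN_le u0))// ler_pM2l//.
  by rewrite mulrC -[X in X * _]div1r; apply: decay; rewrite ge_min lexx orbT.
by rewrite /rho; lra.
Qed.

Let mu_off_le : (mu (off_grid phi n r delta) <=
  ((tail_constant tau + second_moment) * expR (- (cell_rate * u)))%:E)%E.
Proof.
have hV := residual_second_moment hC hphi hlambda tau0 omega1 n.+1.
have hM : (\int[mu]_x (`|x : X| ^+ 2)%:E <= second_moment%:E)%E by rewrite second_momentE.
apply: le_trans (mu_off_grid_le (expR_gt0 _) (expR_gt0 _) hV hM) _.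
rewrite lee_fin mulrDl -!expRM_natl -!expRN lerD//.
  rewrite mulrAC -expRD mulrC ler_wpM2l// -/u.
  rewrite (_ : _ + _ = - (tau / 4 * u)); last by field.
  by apply: decay; rewrite ge_min ler_pM2l// lef_pV2 ?posrE// ler_nat.
rewrite ler_wpM2l//; apply: decay; rewrite ge_min; apply/orP; right; lra.
Qed.

Let err_le : (approx_error mu p t B L I (off_grid phi n r delta) rho <=
  ((3 * L + B + 2 * B * (tail_constant tau + second_moment) `^ p^-1) *
   expR (- (upper_rate * u)))%:E)%E.
Proof.
have cu : expR (- (cell_rate * u)) <= expR (- (upper_rate * u)).
  by rewrite ler_expR lerN2 ler_wpM2r.
have S0 : 0 <= tail_constant tau + second_moment by rewrite addr_ge0.
rewrite mulrDl EFinD; apply: leeD.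
  rewrite lee_fin mulrDl lerD//.
    rewrite [X in _ <= X]mulrAC [X in _ <= X]mulrC ler_pM2l// (le_trans rho_le)//.
    by rewrite ler_pM2l.
  rewrite ler_pM2l//; have /andP[h _] := truncn_expR_bounds u0.
  apply: (@le_trans _ _ (expR u `^ (- t))).
    rewrite !powRN lef_pV2 ?posrE ?powR_gt0 ?expR_gt0//.
    by rewrite ge0_ler_powR ?nnegrE ?expR_ge0 ?(ltW t0).
  rewrite -expRM ler_expR mulrN lerN2 mulrC ler_wpM2l//.
  by rewrite ge_min lexx.
rewrite -mulrA [leRHS]EFinM lee_wpmul2l//; first by rewrite lee_fin mulr_ge0 ?ltW.
apply: (@le_trans _ _ (((tail_constant tau + second_moment) * expR (- (cell_rate * u)))%:E `^ p^-1)%E).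
  apply: gt0_ler_poweR; rewrite ?invr_ge0 ?(ltW p0)//.
  - by rewrite in_itv/= leey measure_ge0.
  - by rewrite in_itv/= leey lee_fin mulr_ge0 ?expR_ge0.
rewrite poweR_EFin lee_fin powRM ?expR_ge0// ler_wpM2l ?powR_ge0//.
rewrite -expRM ler_expR mulNr lerN2 mulrAC ler_wpM2r//.
by rewrite ge_min lexx orbT.
Qed.

Let cardK : #|K|%:R <= expR (3 * (n.+1%:R * u)) :> R.
Proof.
rewrite card_ffun !card_ord natrX.
have /andP[_ h] := truncn_expR_bounds (mulr_ge0 (ler0n R 2) u0).
have e2 : 2 <= expR u by have := expR_ge1Dx u; have := u1; lra.
have h3 : N.+1%:R <= expR (3 * u).
  rewrite (le_trans h)// (_ : 3 * u = u + 2 * u); last by lra.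
  by rewrite expRD ler_pM2r ?expR_gt0.
rewrite mulrCA expRM_natl; apply: lerXn2r; rewrite ?nnegrE ?expR_ge0//.
Qed.

Let I_le : I%:R <= expR (n.+1%:R * u) :> R.
Proof.
rewrite (@le_trans _ _ (expR u))//; first by rewrite truncn_le expR_ge0.
by rewrite ler_expR ler_peMl// ler1n.
Qed.

Let cell0 : K := [ffun=> ord0].

Let cardK_ge1 : 1 <= #|K|%:R :> R.
Proof. by rewrite ler1n; apply/card_gt0P; exists cell0. Qed.

Variable m : nat.
(* There are #|K| <= exp (3 n u) cells and I <= exp (n u) coefficients for each, and
   the noise is at most of order #|K|^3 I / sqrt m: the square root of this sample
   size is exp (11 n u), which leaves a factor exp (- n u). *)
Hypothesis mn : expR (22 * (n.+1%:R * u)) <= m%:R :> R.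

Let m0 : (0 < m)%N.
Proof. by rewrite -(@ltr0n R) (lt_le_trans _ mn)// expR_gt0. Qed.

Let Km : (#|K| <= m)%N.
Proof.
rewrite -(@ler_nat R) (le_trans cardK)// (le_trans _ mn)// ler_expR.
by rewrite ler_wpM2r ?mulr_ge0// ler_nat.
Qed.

Let eta : R := expR (- (11 * (n.+1%:R * u))).
Let eta0 : 0 < eta. Proof. exact: expR_gt0. Qed.

Let minv_eta : m%:R^-1 / eta <= eta.
Proof.
rewrite ler_pdivrMr// -expRD -[leLHS]div1r ler_pdivrMr ?ltr0n//.
rewrite (@le_trans _ _ (expR (- (22 * (n.+1%:R * u))) * expR (22 * (n.+1%:R * u))))//.
  by rewrite -expRD addNr expR0.
rewrite ler_pM ?expR_ge0// ler_expR; lra.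
Qed.

Let cells_eta : #|K|%:R ^+ 3 * I%:R * eta <= expR (- (upper_rate * u)).
Proof.
have nu : 0 <= n.+1%:R * u by rewrite mulr_ge0.
apply: (@le_trans _ _ (expR (3 * (n.+1%:R * u)) ^+ 3 * expR (n.+1%:R * u) * eta)).
  by rewrite ler_pM2r// ler_pM ?exprn_ge0// lerXn2r ?nnegrE ?expR_ge0.
rewrite /eta -expRM_natl -!expRD ler_expR.
have h1 : upper_rate * u <= 1 * u.
  rewrite ler_wpM2r// (le_trans upper_rate_le)// ge_min; apply/orP; right.
  by rewrite ler_pdivrMr// mul1r ler1n.
have h2 : u <= n.+1%:R * u by rewrite ler_peMl// ler1n.
by lra.
Qed.

Let noise_le (a1 a2 : R) : 0 <= a1 -> 0 <= a2 <= 2 * #|K|%:R ^+ 2 ->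
  #|K|%:R * I%:R * (a1 * ((eta + a2 * (m%:R^-1 / eta)) / 2))
    <= 2 * a1 * expR (- (upper_rate * u)).
Proof.
move=> a10 /andP[a20 a2K].
have h : eta + a2 * (m%:R^-1 / eta) <= (1 + 2 * #|K|%:R ^+ 2) * eta.
  rewrite mulrDl mul1r lerD2l ler_pM// divr_ge0 ?invr_ge0//; exact: ltW.
have K2 : 1 <= #|K|%:R ^+ 2 :> R by rewrite exprn_ege1.
apply: (@le_trans _ _ (#|K|%:R * I%:R * (a1 * (4 * #|K|%:R ^+ 2 * eta / 2)))).
  rewrite ler_wpM2l ?mulr_ge0// ler_wpM2l// ler_pM2r// (le_trans h)//.
  by rewrite ler_pM2r//; lra.
rewrite [leLHS](_ : _ = 2 * a1 * (#|K|%:R ^+ 3 * I%:R * eta)); last by field.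
by rewrite ler_wpM2l// mulr_ge0.
Qed.

Let total_risk_le (F : \bar R) (e : R) :
  (F <= approx_error mu p t B L I (off_grid phi n r delta) rho + e%:E)%E ->
  e <= 2 * (1 + B ^+ 2 + sigma) * expR (- (upper_rate * u)) ->
  (F <= (upper_constant * expR (- (upper_rate * u)))%:E)%E.
Proof.
move=> h1 h2; apply: le_trans h1 _.
by rewrite /upper_constant mulrDl EFinD leeD// lee_fin.
Qed.

Lemma fixed_design_risk_dim :
  (fixed_design_risk mu P E sigma p class m <=
   (upper_constant * expR (- (upper_rate * u)))%:E)%E.
Proof.
have rho0 : 0 <= rho by rewrite addr_ge0 ?expR_ge0// mulr_ge0 ?divr_ge0 ?expR_ge0.
have := fixed_design_risk_le mu p1 hY hpsi hw t0 B0 L0 I cell0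
  (measurable_near_cell phi (N := N) r)
  (measurable_off_grid phi n r delta) rho0
  (near_cell_cover basis N (expR_gt0 u)) (@near_cell_close _ _ phi basis n N r delta)
  hE sigma0 Km eta0.
move=> /total_risk_le; apply.
rewrite natrM (_ : _ / m%:R / eta = 2 * #|K|%:R * (m%:R^-1 / eta)); last by rewrite !mulrA.
apply: le_trans (noise_le (ltW sigma0) _) _.
  by rewrite mulr_ge0//= ler_pM2l// expr2 ler_peMl.
by rewrite ler_pM2r ?expR_gt0// ler_pM2l// lerDr addr_ge0// sqr_ge0.
Qed.

Lemma random_design_risk_dim :
  (random_design_risk mu P E sigma p class m <=
   (upper_constant * expR (- (upper_rate * u)))%:E)%E.
Proof.
have rho0 : 0 <= rho by rewrite addr_ge0 ?expR_ge0// mulr_ge0 ?divr_ge0 ?expR_ge0.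
have := random_design_risk_le mu p1 hY hpsi hw t0 B0 L0 I cell0
  (measurable_near_cell phi (N := N) r)
  (measurable_off_grid phi n r delta) rho0
  (near_cell_cover basis N (expR_gt0 u)) (@near_cell_close _ _ phi basis n N r delta)
  hE sigma0 (cell_center_inj basis (expR_gt0 u)) m0 eta0.
move=> /total_risk_le; apply.
rewrite natrM; set Kn : R := #|K|%:R.
rewrite (_ : B ^+ 2 * Kn / m%:R / eta = B ^+ 2 * (Kn * (m%:R^-1 / eta))); last by rewrite !mulrA.
rewrite (_ : Kn ^+ 2 / m%:R / eta = Kn ^+ 2 * (m%:R^-1 / eta)); last by rewrite !mulrA.
have B20 : 0 <= B ^+ 2 by exact: sqr_ge0.
have K0 : 0 <= Kn by exact: ler0n.
have x0 : 0 <= Kn * (m%:R^-1 / eta) by rewrite mulr_ge0// divr_ge0 ?invr_ge0// ltW.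
have K2 : Kn <= 2 * Kn ^+ 2.
  by rewrite expr2 mulrCA ler_peMr//; have := cardK_ge1; rewrite -/Kn; lra.
have h1 : Kn * I%:R * ((1 + B ^+ 2) * ((eta + Kn * (m%:R^-1 / eta)) / 2))
    <= 2 * (1 + B ^+ 2) * expR (- (upper_rate * u)).
  by apply: noise_le; [rewrite addr_ge0|rewrite K0].
have h2 : Kn * I%:R * (sigma * ((eta + Kn ^+ 2 * (m%:R^-1 / eta)) / 2))
    <= 2 * sigma * expR (- (upper_rate * u)).
  by apply: noise_le; [exact: ltW|rewrite sqr_ge0/= ler_peMl ?sqr_ge0// ler1n].
have h3 : Kn * I%:R * ((eta + B ^+ 2 * (Kn * (m%:R^-1 / eta))) / 2)
    <= Kn * I%:R * ((1 + B ^+ 2) * ((eta + Kn * (m%:R^-1 / eta)) / 2)).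
  rewrite ler_wpM2l ?mulr_ge0// [leRHS]mulrA ler_pM2r//.
  have := mulr_ge0 B20 (ltW eta0).
  set s := Kn * _ in x0 *; rewrite mulrDl mul1r mulrDr; lra.
by rewrite mulrDr; lra.
Qed.

End dimension.
End upper_bound.

(** * The two rates *)

Definition lower_rate (R : realType) (tau iota : R) : R :=
  tau / 2 + 1 + `|ln (iota / 2)|.

(** As [1 <= omega], the dimension is at most its power [omega], so the factor
    [(a * b) ^+ n.+1] costs no more than the height of the bumps. *)
Lemma grid_risk_ge (R : realType) (L B : R) (lambda : nat -> R) (a b tau omega : R) n :
  0 < L -> 0 < B -> 0 < a -> 0 < b -> 1 <= omega ->
  (forall i, 0 < lambda i) ->
  (forall i, lambda i = expR (- tau * (i.+1%:R `^ omega))) ->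
  amplitude B L lambda a * a / 16 *
    expR (- (lower_rate tau (2 * a * b) * n.+1%:R `^ omega)) <=
  grid_risk B L lambda a b n (Num.truncn (expR (n.+1%:R `^ omega))).
Proof.
move=> L0 B0 a0 b0 omega1 lambda0 hlambda; set u := n.+1%:R `^ omega.
have [u1 nu] : 1 <= u /\ n.+1%:R <= u by exact: dim_le_speed.
have u0 : 0 <= u by exact: le_trans u1.
have /andP[_ hN] := truncn_expR_bounds u0.
have A0 : 0 < amplitude B L lambda a by exact: amplitude_gt0.
have sqrt_lambda : Num.sqrt (lambda n) = expR (- (tau / 2 * u)).
  rewrite hlambda -/u (_ : - tau * u = 2%:R * - (tau / 2 * u)); last by field.
  by rewrite expRM_natl sqrtr_sqr gtr0_norm ?expR_gt0.
have ab0 : 0 < a * b by rewrite mulr_gt0.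
have pow_ab : expR (- (`|ln (a * b)| * u)) <= (a * b) ^+ n.+1.
  rewrite -[X in X ^+ _]lnK ?posrE// -expRM_natl ler_expR.
  have h1 := ler_norm (- ln (a * b)); rewrite normrN in h1.
  have h2 : n.+1%:R * (- ln (a * b)) <= u * `|ln (a * b)|.
    apply: (@le_trans _ _ (n.+1%:R * `|ln (a * b)|)); first by rewrite ler_wpM2l.
    by rewrite ler_wpM2r.
  by lra.
rewrite /grid_risk sqrt_lambda /lower_rate.
rewrite (_ : 2 * a * b / 2 = a * b); last by field.
have -> : - ((tau / 2 + 1 + `|ln (a * b)|) * u) =
    - (tau / 2 * u) + - u + - (`|ln (a * b)| * u) by ring.
rewrite !expRD !mulrA; apply: ler_pM => //.
  by rewrite !mulr_ge0 ?expR_ge0 ?(ltW A0) ?(ltW a0).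
set N := Num.truncn _ in hN *; set q := expR (- (tau / 2 * u)).
set A := amplitude B L lambda a in A0 *.
have N0 : 0 < N.+1%:R :> R by [].
have q0 : 0 <= q * a by rewrite mulr_ge0 ?expR_ge0// ltW.
rewrite [leLHS](_ : _ = A * (q * a) * (expR (- u) / 16)); last by ring.
rewrite [leRHS](_ : _ = A * (q * a) * (8 * N.+1%:R)^-1); last by ring.
rewrite ler_wpM2l ?(mulr_ge0 (ltW A0) q0)//.
rewrite expRN -invfM lef_pV2 ?posrE ?mulr_gt0 ?expR_gt0//.
by lra.
Qed.

Lemma initial_segment_has0 (R : realType) (Y : hilbertType R) (D : set nat) (psi : nat -> Y) :
  initial_segment D -> orthonormal_basis D psi -> (exists y : Y, y != 0) -> D 0%N.
Proof.
move=> [->//|[[|n] ->//]] [_ hpsi] [y /eqP y0]; exfalso; apply: y0.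
rewrite -[LHS](cvg_lim (@norm_hausdorff _ _) (hpsi y)).
rewrite (_ : (fun _ => _) = cst 0); last first.
  by apply/funext => n; rewrite big1// => i; rewrite inE.
by apply: cvg_lim; [exact: norm_hausdorff|exact: cvg_cst].
Qed.

Theorem theorem2p6 (R : realType) (tau omega iota t p : R)
    (htau : 0 < tau) (homega : 1 <= omega) (ht : 0 < t) (hp : 1 <= p) :
  exists c1 c2 : R, [/\ 0 < c1, 0 < c2 &
  forall (X Y : hilbertType R) (hX : separable X) (hY : separable Y)
    (hY0 : exists y : Y, y != 0)
    (B L sigma : R) (hB : 0 < B) (hL : 0 < L) (hsigma : 0 < sigma)
    (mu : probability (borel X) R)
    (mu_mean : mean_zero mu) (mu_moment : finite_second_moment mu)
    (C : X -> X) (lambda : nat -> R) (phi : nat -> X)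
    (hC : covariance_operator mu C) (hphi : spectral_basis C lambda phi)
    (hlambda : forall i, lambda i = expR (- tau * (i.+1%:R `^ omega)))
    (mu_indep : independent_rvs mu (kl_coord lambda phi))
    (a b : R) (ha : 0 < a) (hb : 0 < b) (hiota : iota = 2 * a * b)
    (mu_lower : small_ball_density mu (kl_coord lambda phi) a b)
    (mu_upper : bounded_moments mu p (kl_coord lambda phi))
    (D : set nat) (psi : nat -> Y) (w : nat -> R)
    (hD : initial_segment D) (hpsi : orthonormal_basis D psi)
    (hw : forall i, w i = i.+1%:R)
    (d : measure_display) (Omega : measurableType d) (P : probability Omega R)
    (E : nat -> Y -> Omega -> R) (hE : iid_white_noise P E),
  let class := @lipschitz_class R X Y D psi w t B L in
  let rate m := (ln (m%:R / sigma ^+ 2) `^ (omega / (omega + 1)))%:E in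
  let fixed m := (- lne (fixed_design_risk mu P E sigma p class m))%E in
  let random m := (- lne (random_design_risk mu P E sigma p class m))%E in
  [/\ lesssim c1 fixed rate, lesssim c2 rate fixed,
      lesssim c1 random rate & lesssim c2 rate random]].
Proof.
pose C1 := lower_rate tau iota.
pose C2 := upper_rate p t tau.
have C10 : 0 < C1 by rewrite ltr_wpDr// addr_gt0// divr_gt0.
have C20 : 0 < C2 by exact: upper_rate_gt0.
exists (2 * (C1 * 2 `^ omega + 1)).
exists (2 * 2 `^ omega * (2 * 22) `^ (omega / (omega + 1)) / C2).
split; first by rewrite mulr_gt0// addr_gt0// mulr_gt0// powR_gt0.
  by rewrite divr_gt0// !mulr_gt0// powR_gt0.
move=> X Y hX hY hY0 B L sigma hB hL hsigma mu _ mu_moment C lambda phi hC hphi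
  hlambda mu_indep a b ha hb hiota mu_lower _ D psi w hD hpsi hw d Omega P E hE
  class rate fixed random.
have [lambda0 lambda_noninc hbasis _] := hphi.
have D0 := initial_segment_has0 hD hpsi hY0.
have mE := measurable_noise hE.
have A0 : 0 < amplitude B L lambda a * a / 16.
  by rewrite divr_gt0// mulr_gt0// amplitude_gt0.
have grid_size n m : (2 * m)%:R <= expR (n.+1%:R * n.+1%:R `^ omega) :> R ->
    (2 * m <= (Num.truncn (expR (n.+1%:R `^ omega : R))).+1 ^ n.+1)%N.
  move=> h; rewrite -(@ler_nat R) (le_trans h)// natrX expRM_natl.
  have /andP[h1 _] := truncn_expR_bounds (powR_ge0 (n.+1%:R : R) omega).
  by rewrite lerXn2r ?nnegrE ?expR_ge0.
have risk_ge n := grid_risk_ge n hL hB ha hb homega lambda0 hlambda.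
have U0 : 0 < upper_constant mu p B L tau sigma.
  rewrite /upper_constant -addrA ltr_wpDr//; last by rewrite addr_gt0// mulr_gt0.
  by rewrite addr_ge0 ?mulr_ge0 ?powR_ge0 ?addr_ge0 ?sqr_ge0 ?(ltW hB) ?(ltW hsigma).
split.
- apply: (lesssim_neg_ln_of_ge homega hsigma A0 C10) => -[//|n] m _ /grid_size hm.
  apply: le_trans (fixed_design_risk_ge_grid hp hY t hpsi hw D0 hL hB lambda0
    lambda_noninc hbasis ha hb mu_indep mu_lower P sigma mE hm).
  by rewrite lee_fin /C1 hiota.
- apply: (lesssim_rate_of_le homega hsigma U0 C20) => // -[//|n] m _ hm.
  exact: (fixed_design_risk_dim hp hY hpsi hw ht hB hL hC hphi hlambda htau homega mu_moment hE hsigma hm).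
- apply: (lesssim_neg_ln_of_ge homega hsigma A0 C10) => -[//|n] m _ /grid_size hm.
  apply: le_trans (random_design_risk_ge_grid hp hY t hpsi hw D0 hL hB lambda0
    lambda_noninc hbasis ha hb mu_indep mu_lower P sigma mE hm).
  by rewrite lee_fin /C1 hiota.
- apply: (lesssim_rate_of_le homega hsigma U0 C20) => // -[//|n] m _ hm.
  exact: (random_design_risk_dim hp hY hpsi hw ht hB hL hC hphi hlambda htau homega mu_moment hE hsigma hm).
Qed.
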